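(* Each of the groups $SO(3)$, $SO^+(2,1)$ and $SL_3(\mathbb{R})$ (these being the 3-dimensional candidates in the Merkulov–Schwachhöfer classification of irreducible holonomy groups of torsion-free affine connections that lie inside $SL_3(\mathbb{R})$) arises as the $\nabla^\phi$-holonomy group $Hol^\phi$ of some 3-dimensional manifold with density $(M^3,g,\phi)$.
   Context: A manifold with density $(M,g,\phi)$ is a smooth connected manifold $M$ with a Riemannian metric $g$ and a smooth function $\phi:M\to\mathbb{R}$. Let $\nabla$ be the Levi-Civita connection of $g$. The weighted connection is the torsion-free affine connection $\nabla^\phi_X Y=\nabla_X Y-d\phi(X)Y-d\phi(Y)X$. For $p\in M$, $Hol^\phi_p$ is the group of all linear maps $T_pM\to T_pM$ obtained by $\nabla^\phi$-parallel translation along piecewise $C^1$ loops based at $p$. Choosing a basis of $T_pM$ identifies $Hol^\phi_p$ with a subgroup of $GL_n(\mathbb{R})$ ($n=\dim M$), well defined up to conjugation and independent of $p$ up to conjugation; ''$Hol^\phi$ is $G$'' means that it equals $G$ for a suitable choice of basis. $SO^+(p,q)$ denotes the identity component of $SO(p,q)$. *)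

(* Defs.v *)
From HB Require Import structures.
From mathcomp Require Import all_boot all_order all_algebra.
From mathcomp Require Import all_classical all_reals all_analysis.
From mathcomp Require Import ring.

Set Implicit Arguments.
Unset Strict Implicit.
Unset Printing Implicit Defensive.

Import Order.TTheory GRing.Theory Num.Theory.
Import numFieldNormedType.Exports.

Local Open Scope classical_set_scope.
Local Open Scope ring_scope.

Section Smoothness.
Variables (R : realType) (n : nat).
Implicit Types (U : set 'rV[R]_n) (f : 'rV[R]_n -> R).

Definition partial (a : 'I_n) f : 'rV[R]_n -> R := fun x => 'D_('e_a) f x.

(* Meant for open U: the values of f outside U are irrelevant. *)
Fixpoint Ck (k : nat) U f : Prop :=
  (forall x, U x -> {for x, continuous f}) /\
  match k with
  | 0 => True
  | k'.+1 => forall a : 'I_n,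
      (forall x, U x -> derivable f x 'e_a) /\ Ck k' U (partial a f)
  end.

Definition smooth_on U f : Prop := forall k, Ck k U f.

End Smoothness.

(* A smooth atlas is a family of charts [chart i : dom i -> 'rV_n] with inverse
   [chart_inv i]; both are total functions, but [chart i] is only meaningful on
   [dom i] and [chart_inv i] on [img i]. *)
Record smooth_manifold (R : realType) (n : nat) := SmoothManifold {
  carrier :> topologicalType;
  chart_index : Type;
  dom : chart_index -> set carrier;
  chart : chart_index -> carrier -> 'rV[R]_n;
  chart_inv : chart_index -> 'rV[R]_n -> carrier;
  manifold_hausdorff : hausdorff_space carrier;
  manifold_second_countable : @second_countable carrier;
  dom_cover : forall p, exists i, dom i p;
  dom_open : forall i, open (dom i);
  img_open : forall i, open (chart i @` dom i);
  chartK : forall i p, dom i p -> chart_inv i (chart i p) = p;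
  chart_continuous : forall i p, dom i p -> {for p, continuous (chart i)};
  chart_inv_continuous : forall i x, (chart i @` dom i) x ->
    {for x, continuous (chart_inv i)};
  transition_smooth : forall i j b,
    smooth_on (chart i @` (dom i `&` dom j))
      (fun x => chart j (chart_inv i x) ord0 b)
}.

Arguments chart_index {R n} M : rename.
Arguments dom {R n M} i : rename.
Arguments chart {R n M} i _ : rename.
Arguments chart_inv {R n M} i _ : rename.

Section Tangent.
Variables (R : realType) (n : nat) (M : smooth_manifold R n).

Definition img (i : chart_index M) : set 'rV[R]_n := chart i @` dom i.

(* Vectors are rows, so the differential of the transition map from chart i to
   chart j at p acts by right multiplication by [jac i j p]. *)
Definition jac (i j : chart_index M) (p : M) : 'M[R]_n :=
  \matrix_(a, b)
    partial a (fun x => chart j (chart_inv i x) ord0 b) (chart i p).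

(* A tangent vector at p is given by its components in every chart around p,
   related by the change of coordinates; the components in the charts that do
   not contain p are set to 0. *)
Definition is_tangent (p : M) : {pred chart_index M -> 'rV[R]_n} :=
  [pred v | `[< (forall i, ~ dom i p -> v i = 0) /\
                (forall i j, dom i p -> dom j p -> v j = v i *m jac i j p) >]].

Fact is_tangent_submod_closed p : submod_closed (is_tangent p).
Proof.
split=> [|c u v /asboolP[u0 uJ] /asboolP[v0 vJ]]; apply/asboolP; split.
- by [].
- by move=> i j _ _; rewrite mul0mx.
- move=> i ip; have -> : (c *: u + v) i = c *: u i + v i by [].
  by rewrite u0 // v0 // scaler0 addr0.
- move=> i j ip jp; have E k : (c *: u + v) k = c *: u k + v k by [].
  by rewrite !E (uJ i j) // (vJ i j) // mulmxDl scalemxAl.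
Qed.

HB.instance Definition _ p :=
  GRing.isSubmodClosed.Build R (chart_index M -> 'rV[R]_n) (is_tangent p)
    (is_tangent_submod_closed p).

Record tangent (p : M) := Tangent {
  components :> chart_index M -> 'rV[R]_n;
  components_tangent : components \in is_tangent p
}.

HB.instance Definition _ p := [isSub for @components p].
HB.instance Definition _ p := [Choice of tangent p by <:].
HB.instance Definition _ p := [SubChoice_isSubLmodule of tangent p by <:].

Definition tangent_basis (p : M) (e : 'I_n -> tangent p) : Prop :=
  forall v : tangent p, exists! c : 'rV[R]_n, v = \sum_k c ord0 k *: e k.

End Tangent.

Section Connection.
Variables (R : realType) (n : nat).

(* The Christoffel symbols of an affine connection on a coordinate domain:
   [Gam x k a b] is the k-th component of nabla_{d_a} d_b at x. *)
Definition symbols := 'rV[R]_n -> 'I_n -> 'I_n -> 'I_n -> R.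

Definition torsion_free_at (Gam : symbols) (x : 'rV[R]_n) : Prop :=
  forall k a b, Gam x k a b = Gam x k b a.

Definition metric_compatible_at (G : 'rV[R]_n -> 'M[R]_n) (Gam : symbols)
    (x : 'rV[R]_n) : Prop :=
  forall c a b, partial c (fun y => G y a b) x =
    \sum_d (Gam x d c a * G x d b + Gam x d c b * G x a d).

Definition levi_civita (G : 'rV[R]_n -> 'M[R]_n) : symbols := fun x k a b =>
  2^-1 * \sum_l invmx (G x) k l *
    (partial a (fun y => G y l b) x + partial b (fun y => G y l a) x
     - partial l (fun y => G y a b) x).

(* nabla^phi_X Y = nabla_X Y - dphi(X) Y - dphi(Y) X *)
Definition weighted (Gam : symbols) (phi : 'rV[R]_n -> R) : symbols :=
  fun x k a b =>
  Gam x k a b - partial a phi x * (k == b)%:R - partial b phi x * (k == a)%:R.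

(* Fundamental theorem of Riemannian geometry, in coordinates. *)
Lemma levi_civitaP (U : set 'rV[R]_n) (G : 'rV[R]_n -> 'M[R]_n)
    (Gam : symbols) (x : 'rV[R]_n) :
  open U -> U x -> (forall y, U y -> (G y)^T = G y) -> G x \in unitmx ->
  torsion_free_at Gam x /\ metric_compatible_at G Gam x <->
  Gam x = levi_civita G x.
Proof.
move=> Uo Ux Gsym Gu.
have pS c a b : partial c (fun y => G y a b) x = partial c (fun y => G y b a) x.
  apply: near_eq_derive.
  near=> y; have Uy : U y by near: y; exact: open_nbhs_nbhs.
  by rewrite -{1}(Gsym y Uy) mxE.
have GS a b : G x a b = G x b a by rewrite -{1}(Gsym x Ux) mxE.
have two : (2 : R) != 0 by rewrite pnatr_eq0.
pose K a b l := partial a (fun y => G y l b) x + partial b (fun y => G y l a) x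
     - partial l (fun y => G y a b) x.
have low a b l : \sum_d G x l d * levi_civita G x d a b = 2^-1 * K a b l.
  under eq_bigr do rewrite /levi_civita mulrCA mulr_sumr.
  rewrite -mulr_sumr; congr (_ * _).
  rewrite exchange_big /=.
  under eq_bigr => m _ do under eq_bigr => d _ do rewrite mulrA.
  have D m : \sum_d G x l d * invmx (G x) d m = (l == m)%:R.
    by have /matrixP/(_ l m) := mulmxV Gu; rewrite !mxE.
  under eq_bigr => m _ do rewrite -mulr_suml D.
  rewrite (bigD1 l) //= big1 => [|m ml]; first by rewrite eqxx mul1r addr0.
  by rewrite eq_sym (negbTE ml) mul0r.
split=> [[tf mc]|eG].
- apply/funext => k; apply/funext => a; apply/funext => b.
  have lowG l : \sum_d G x l d * Gam x d a b = 2^-1 * K a b l.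
    apply: (mulfI two); rewrite mulVKf // /K !mc -!big_split /=.
    rewrite -sumrB mulr_sumr.
    apply: eq_bigr => d _.
    rewrite (tf d b a) (tf d a l) (tf d b l) (GS d a).
    ring.
  pose v := \col_d (Gam x d a b - levi_civita G x d a b).
  have Gv : G x *m v = 0.
    apply/colP => l; rewrite !mxE.
    under eq_bigr do rewrite mxE mulrBr.
    by rewrite sumrB lowG low subrr.
  have v0 : v = 0 by rewrite -(mul1mx v) -(mulVmx Gu) -mulmxA Gv mulmx0.
  by apply/subr0_eq; have /colP/(_ k) := v0; rewrite !mxE.
- have tf : torsion_free_at Gam x.
    move=> k a b; rewrite eG /levi_civita; congr (_ * _).
    apply: eq_bigr => l _; congr (_ * _).
    by rewrite (pS l a b) [X in X - _]addrC.
  split=> // c a b.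
  rewrite big_split /=.
  under eq_bigr do rewrite eG mulrC GS.
  under [X in _ = _ + X]eq_bigr do rewrite eG mulrC.
  rewrite !low /K (pS c b a) (pS a b c) (pS b c a).
  by field.
Unshelve. all: by end_near. Qed.

End Connection.

Record manifold_with_density (R : realType) (n : nat) := ManifoldWithDensity {
  mwd_manifold :> smooth_manifold R n;
  mwd_nonempty : [set: mwd_manifold] !=set0;
  mwd_connected : connected [set: mwd_manifold];
  (* [metric i x] is the Gram matrix of the coordinate frame of chart i *)
  metric : chart_index mwd_manifold -> 'rV[R]_n -> 'M[R]_n;
  metric_smooth : forall i a b, smooth_on (img i) (fun x => metric i x a b);
  metric_sym : forall i x, img i x -> (metric i x)^T = metric i x;
  metric_posdef : forall i x, img i x ->
    forall v : 'rV[R]_n, v != 0 -> 0 < (v *m metric i x *m v^T) ord0 ord0;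
  metric_change : forall i j p, dom i p -> dom j p ->
    metric i (chart i p) =
      jac i j p *m metric j (chart j p) *m (jac i j p)^T;
  density : mwd_manifold -> R;
  density_smooth : forall i, smooth_on (img i) (density \o chart_inv i)
}.

Arguments metric {R n M} i _ : rename.
Arguments density {R n} M _ : rename.

Section Holonomy.
Variables (R : realType) (n : nat).

(* Derivative at t relative to [a, b], hence one-sided at the endpoints. *)
Definition deriv_within (a b : R) (f : R -> 'rV[R]_n) (t : R) (l : 'rV[R]_n) :=
  (s - t)^-1 *: (f s - f t) @[s --> within `[a, b] t^'] --> l.

Definition C1_on (M : smooth_manifold R n) (a b : R) (gam : R -> M) : Prop :=
  exists w : chart_index M -> R -> 'rV[R]_n,
  forall i t, t \in `[a, b] -> dom i (gam t) ->
    deriv_within a b (chart i \o gam) t (w i t) /\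
    w i s @[s --> within `[a, b] (nbhs t)] --> w i t.

Definition on_pieces (s : seq R) (P : R -> R -> Prop) : Prop :=
  forall k, (k < size s)%N -> P (nth 0 (0 :: s) k) (nth 0 s k).

Definition piecewise_C1 (M : smooth_manifold R n) (s : seq R) (gam : R -> M) :
    Prop :=
  [/\ itv_partition 0 1 s, {within `[0, 1], continuous gam} &
      on_pieces s (fun a b => C1_on a b gam)].

(* V' + Gam(gam', V) = 0 in every chart *)
Definition parallel_on (M : smooth_manifold R n)
    (Gam : chart_index M -> symbols R n) (a b : R) (gam : R -> M)
    (V : R -> chart_index M -> 'rV[R]_n) : Prop :=
  forall i t w, t \in `[a, b] -> dom i (gam t) ->
    deriv_within a b (chart i \o gam) t w ->
    deriv_within a b (V ^~ i) t
      (- \row_k \sum_c \sum_d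
          Gam i (chart i (gam t)) k c d * w ord0 c * V t i ord0 d).

Definition parallel_translation (M : smooth_manifold R n)
    (Gam : chart_index M -> symbols R n) (s : seq R) (gam : R -> M)
    (u v : chart_index M -> 'rV[R]_n) : Prop :=
  exists V : R -> chart_index M -> 'rV[R]_n,
    [/\ forall t, t \in `[0, 1] -> V t \in is_tangent (gam t),
        on_pieces s (fun a b => parallel_on Gam a b gam V),
        V 0 = u & V 1 = v].

Variable M : manifold_with_density R n.

Definition weighted_connection (i : chart_index M) : symbols R n :=
  weighted (levi_civita (metric i)) (density M \o chart_inv i).

Definition Hol (p : M) : set {linear tangent p -> tangent p} :=
  [set L : {linear tangent p -> tangent p} | exists s (gam : R -> M),
    [/\ piecewise_C1 s gam, gam 0 = p, gam 1 = p &
        forall u : tangent p,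
          parallel_translation weighted_connection s gam u (L u)]].

Definition Hol_is (G : set 'M[R]_n) : Prop :=
  forall p : M, exists2 e : 'I_n -> tangent p, tangent_basis e &
    G = [set A | exists2 L, Hol L &
           forall j, L (e j) = \sum_k A k j *: e k].

End Holonomy.

Section Groups.
Variable R : realType.

Definition SL (n : nat) : set 'M[R]_n := [set A | \det A = 1].

Definition SO (n : nat) : set 'M[R]_n :=
  [set A | A^T *m A = 1%:M /\ \det A = 1].

Definition signature_form (p q : nat) : 'M[R]_(p + q) :=
  block_mx 1%:M 0 0 (- 1%:M).

Definition SOpq (p q : nat) : set 'M[R]_(p + q) :=
  [set A | A^T *m signature_form p q *m A = signature_form p q /\ \det A = 1].

Definition SOplus (p q : nat) : set 'M[R]_(p + q) :=
  connected_component (@SOpq p q) 1%:M.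

End Groups.

Arguments SL R n _ : clear implicits.
Arguments SO R n _ : clear implicits.
Arguments SOpq R p q _ : clear implicits.
Arguments SOplus R p q _ : clear implicits.

(* Main.v *)
Require Import Defs.
From HB Require Import structures.
From mathcomp Require Import all_boot all_order all_algebra.
From mathcomp Require Import all_classical all_reals all_analysis.
From mathcomp Require Import ring lra.

(** All three groups already occur on R^3 with a flat metric, the whole
    geometry being put into the density.  Let w = (e^(2x) + y^2 + eps z^2) / 2
    with eps = 1 or -1, let g = dw^2 + dy^2 + dz^2 be written in the coordinates
    (x, y, z) (indices 0, 1, 2), and let phi = q(x) for a polynomial q.  The
    only non-zero Christoffel symbols of g have upper index x.  Rescale the
    coordinate frame by (X^2 / Y, X, X), where X = e^phi and Y = e^(2x).  In the
    rescaled frame the connection form of nabla^phi has no dx component, and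
    its dy and dz components depend on x alone and live in the planes (0, 1)
    and (0, 2) ([parallel_frame], [frame_parallel]):

      omega(d_y) = beta E_01 - alpha E_10,
      omega(d_z) = beta E_02 - eps alpha E_20,

    acting on rows, with alpha = 1 / X and beta = phi' X / Y.

    Hence parallel translation is the identity along x-lines and a planar
    one-parameter group along y- and z-lines.  The loop that moves to x = a,
    then by l in a transverse direction k, then to x = b, then back by -l, and
    returns along an x-line, has holonomy exp(l omega_k(a)) exp(-l omega_k(b))
    ([reaches_rectangle]).  Since the frame does not see x-lines, the resulting
    matrices are the same at every base point, and concatenating loops
    multiplies them.

    For phi = x one has X^2 = Y and alpha = beta: nabla^phi is the Levi-Civita
    connection of dx^2 + e^(-2x) (dy^2 + eps dz^2), of constant curvature, in
    accordance with Beltrami's theorem.  The form diag(1, 1, eps) is parallel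
    ([form_transport]), and the rectangles realize all rotations of the plane
    (0, 1) and all rotations (eps = 1) or boosts (eps = -1) of the plane (0, 2)
    ([reaches_turn]).  These generate SO(3), respectively the isometries of
    determinant 1 that preserve the sheets of the hyperboloid
    ([isometry_generated]), and the latter form SO^+(2,1) ([SOplus21P]).

    For phi = x - x^3 / 3 and eps = 1, phi' vanishes at x = 1 and x = -1, where
    phi takes different values, so that the rectangle between these two levels
    gives shears; the level x = 0, where alpha = beta = 1, gives rotations,
    which conjugate the shears into their transposes.  Together they generate
    SL_3(R) ([SL3_generated]), and no more can occur because omega has trace
    zero ([det_transport]).

    [Hol_isP] reduces the computation of the holonomy group to these two
    inclusions. *)

Set Implicit Arguments.
Unset Strict Implicit.
Unset Printing Implicit Defensive.

Import Order.TTheory GRing.Theory Num.Theory.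
Import numFieldNormedType.Exports.

Local Open Scope classical_set_scope.
Local Open Scope ring_scope.

(** * Indices, and the topology of row vectors *)

Lemma ord3_case (P : 'I_3 -> Prop) : P 0 -> P 1 -> P 2 -> forall i, P i.
Proof.
move=> P0 P1 P2 [[|[|[|//]]] ilt].
- by rewrite (_ : Ordinal _ = 0) //; apply: val_inj.
- by rewrite (_ : Ordinal _ = 1) //; apply: val_inj.
- by rewrite (_ : Ordinal _ = 2) //; apply: val_inj.
Qed.

Lemma sum3 (V : nmodType) (F : 'I_3 -> V) : \sum_i F i = F 0 + F 1 + F 2.
Proof.
rewrite !big_ord_recr big_ord0 /= add0r.
by congr (F _ + F _ + F _); apply: val_inj.
Qed.

(** Boxes with rational endpoints form a countable basis. *)
Lemma rV_second_countable (R : realType) (n : nat) :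
  @second_countable 'rV[R]_n.
Proof.
pose box (q : 'rV[rat]_n * 'rV[rat]_n) : set 'rV[R]_n :=
  [set v | forall j, ratr (q.1 ord0 j) < v ord0 j < ratr (q.2 ord0 j)].
have box_open q : open (box q).
  rewrite openE => v vq; rewrite /interior.
  exists (fun=> fun j => [set` `]ratr (q.1 ord0 j), ratr (q.2 ord0 j)[ ]).
    by move=> i j; rewrite ord1; apply: near_in_itvoo; rewrite in_itv /= vq.
  by move=> w Hw j; have := Hw ord0 j; rewrite /= in_itv.
exists (range box).
  exact: sub_countable (card_image_le _ _) (countableP _).
split; first by move=> _ [q _ <-].
move=> v A [P vP sPA].
have wit j : {q : rat * rat | ratr q.1 < v ord0 j < ratr q.2 &
    [set` `](ratr q.1 : R), ratr q.2[ ] `<=` P ord0 j}.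
  apply: cid2.
  have /nbhs_ballP[e /= e0 eP] := vP ord0 j.
  have lo : v ord0 j - e < v ord0 j by rewrite ltrBlDr ltrDl.
  have hi : v ord0 j < v ord0 j + e by rewrite ltrDl.
  have [q1] := rat_in_itvoo lo; have [q2] := rat_in_itvoo hi.
  rewrite !in_itv /= => /andP[q2l q2h] /andP[q1l q1h].
  exists (q1, q2) => /=; first by rewrite q1h q2l.
  move=> x; rewrite /= in_itv /= => /andP[xl xh]; apply: eP.
  by rewrite /ball /= ltr_distlC (lt_trans q1l) //= (lt_trans xh).
pose q := (\row_j (s2val (wit j)).1, \row_j (s2val (wit j)).2).
exists (box q).
  by split; [exists q | move=> j; rewrite !mxE; exact: s2valP (wit j)].
move=> w qw; apply: sPA => i j; rewrite ord1.
by apply: (s2valP' (wit j)); have := qw j; rewrite !mxE /= in_itv.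
Qed.

Lemma rV_connected (R : realType) (n : nat) : connected [set: 'rV[R]_n].
Proof.
have -> : [set: 'rV[R]_n] = \bigcup_(v in [set: 'rV[R]_n])
    ((fun t : R => t *: v) @` `[0, 1]).
  apply/seteqP; split => // v _; exists v => //; exists 1; last exact: scale1r.
  by rewrite /= in_itv /= ler01 lexx.
apply: bigcup_connected.
  exists 0 => v _; exists 0; last exact: scale0r.
  by rewrite /= in_itv /= ler01 lexx.
move=> v _; apply: connected_continuous_connected.
  exact: segment_connected.
apply: continuous_subspaceT => t; exact: scalel_continuous.
Qed.

(** * Smooth functions of several variables *)

(** Reduces directional derivatives to one real variable, where the
    rules for compositions are available. *)
Lemma is_derive_line (R : realType) (V : normedModType R) (f : V -> R)
    (x v : V) (df : R) :
  is_derive (0 : R) (1 : R) (fun h => f (h *: v + x)) df -> is_derive x v f df.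
Proof.
move=> [D E]; split; first by have [_ /(_ D)] := derivable1P f x v.
rewrite -E /derive; set g1 := fun h => _; set g2 := fun h => _.
suff -> : g1 = g2 by [].
by apply/funext => h; rewrite /g1 /g2 /= addr0 scale0r add0r [h *: 1]mulr1.
Qed.

Section SmoothFunctions.
Variables (R : realType) (n : nat).
Implicit Types (f g : 'rV[R]_n -> R) (x : 'rV[R]_n) (a b : 'I_n).

Lemma is_derive_coord x a b :
  is_derive x 'e_a (fun y : 'rV[R]_n => y ord0 b) (b == a)%:R.
Proof.
apply: is_derive_line.
rewrite (_ : (fun _ => _) = fun h => h * (b == a)%:R + x ord0 b); last first.
  by apply/funext => h; rewrite !mxE eqxx.
by apply: is_derive_eq; rewrite /GRing.scale /=; ring.
Qed.

Lemma is_derive_exp_coord (c : R) x a b :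
  is_derive x 'e_a (fun y : 'rV[R]_n => expR (c * y ord0 b))
    ((b == a)%:R * c * expR (c * x ord0 b)).
Proof.
apply: is_derive_line.
rewrite (_ : (fun _ => _) =
    expR \o fun h => c * (h * (b == a)%:R + x ord0 b)); last first.
  by apply/funext => h; rewrite /= !mxE eqxx.
apply: is_derive_eq.
by rewrite mul0r add0r /GRing.scale /=; ring.
Qed.

Lemma Ck_mono k f : Ck k.+1 setT f -> Ck k setT f.
Proof.
elim: k f => [|k IH] f [fc fd]; first by split.
by split=> // a; have [d p] := fd a; split=> //; apply: IH.
Qed.

Lemma Ck_cst k (c : R) : Ck k setT (fun _ : 'rV[R]_n => c).
Proof.
elim: k c => [|k IH] c; (split=> [x _|]; [exact: cst_continuous | move=> //= a]).
split=> [x _|]; first exact: derivable_cst.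
by rewrite (_ : partial _ _ = fun=> 0) //; apply/funext => x; apply: derive_cst.
Qed.

Lemma CkD k f g : Ck k setT f -> Ck k setT g -> Ck k setT (fun x => f x + g x).
Proof.
elim: k f g => [|k IH] f g [fc fd] [gc gd].
  by split=> // x _; apply: continuousD; [exact: fc | exact: gc].
split=> [x _|a]; first by apply: continuousD; [exact: fc | exact: gc].
have [[fa fp] [ga gp]] := (fd a, gd a).
split=> [x _|]; first by apply: derivableD; [exact: fa | exact: ga].
rewrite (_ : partial _ _ = fun x => partial a f x + partial a g x).
  exact: IH.
by apply/funext => x; apply: deriveD; [exact: fa | exact: ga].
Qed.

(** The induction needs [Ck_mono], since the product rule brings back the
    undifferentiated factors. *)
Lemma CkM k f g : Ck k setT f -> Ck k setT g -> Ck k setT (fun x => f x * g x).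
Proof.
elim: k f g => [|k IH] f g.
  move=> [fc _] [gc _]; split=> // x _.
  by apply: continuousM; [exact: fc | exact: gc].
move=> fk gk; have [[fc fd] [gc gd]] := (fk, gk).
split=> [x _|a]; first by apply: continuousM; [exact: fc | exact: gc].
have [[fa fp] [ga gp]] := (fd a, gd a).
split=> [x _|]; first by apply: derivableM; [exact: fa | exact: ga].
rewrite (_ : partial _ _ = fun x => f x * partial a g x + g x * partial a f x).
  by apply: CkD; apply: IH => //; exact: Ck_mono.
by apply/funext => x; apply: deriveM; [exact: fa | exact: ga].
Qed.

Lemma smooth_cst (c : R) : smooth_on setT (fun _ : 'rV[R]_n => c).
Proof. by move=> k; exact: Ck_cst. Qed.

Lemma smoothD f g : smooth_on setT f -> smooth_on setT g ->
  smooth_on setT (fun x => f x + g x).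
Proof. by move=> fs gs k; exact: CkD. Qed.

Lemma smoothM f g : smooth_on setT f -> smooth_on setT g ->
  smooth_on setT (fun x => f x * g x).
Proof. by move=> fs gs k; exact: CkM. Qed.

Lemma smooth_coord b : smooth_on setT (fun x : 'rV[R]_n => x ord0 b).
Proof.
have E x : {for x, continuous (fun y : 'rV[R]_n => y ord0 b)}.
  exact (@coord_continuous R 1 n ord0 b x).
case=> [|k]; (split; [by move=> x _; exact: E | move=> //= a]).
split=> [x _|]; first by have [] := is_derive_coord x a b.
rewrite (_ : partial _ _ = fun=> (b == a)%:R); first exact: Ck_cst.
by apply/funext => x; have [_] := is_derive_coord x a b.
Qed.

Lemma smooth_exp_coord (c : R) b :
  smooth_on setT (fun x : 'rV[R]_n => expR (c * x ord0 b)).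
Proof.
have E x : {for x, continuous (fun x : 'rV[R]_n => expR (c * x ord0 b))}.
  apply: (@continuous_comp _ _ _ (fun x : 'rV[R]_n => c * x ord0 b) expR).
    have cc := @coord_continuous R 1 n ord0 b x.
    apply: (@continuousM _ _ (cst c) (fun y : 'rV[R]_n => y ord0 b) x _ cc).
    exact: cst_continuous.
  exact: continuous_expR.
elim=> [|k IH]; (split; [by move=> x _; exact: E | move=> //= a]).
split=> [x _|]; first by have [] := is_derive_exp_coord c x a b.
rewrite (_ : partial _ _ = fun x => (b == a)%:R * c * expR (c * x ord0 b)).
  by apply: CkM => //; exact: Ck_cst.
by apply/funext => x; have [_] := is_derive_exp_coord c x a b.
Qed.

Lemma smooth_horner_coord (q : {poly R}) b :
  smooth_on setT (fun x : 'rV[R]_n => q.[x ord0 b]).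
Proof.
elim/poly_ind: q => [|q c IH].
  rewrite (_ : (fun _ => _) = fun=> 0); first exact: smooth_cst.
  by apply/funext => x; rewrite horner0.
rewrite (_ : (fun _ => _) = fun x => q.[x ord0 b] * x ord0 b + c).
  apply: smoothD; last exact: smooth_cst.
  by apply: smoothM => //; exact: smooth_coord.
by apply/funext => x; rewrite !hornerE.
Qed.

Lemma is_derive_horner_coord (q : {poly R}) x a b :
  is_derive x 'e_a (fun y : 'rV[R]_n => q.[y ord0 b])
    ((b == a)%:R * q^`().[x ord0 b]).
Proof.
apply: is_derive_line.
rewrite (_ : (fun _ => _) =
    horner q \o fun h => h * (b == a)%:R + x ord0 b); last first.
  by apply/funext => h; rewrite /= !mxE eqxx.
apply: is_derive_eq.
by rewrite mul0r add0r /GRing.scale /=; ring.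
Qed.

End SmoothFunctions.

(** * Coordinate space as a manifold *)

Section CoordinateSpace.
Variables (R : realType) (n : nat).

Fact coordinate_cover (p : 'rV[R]_n) : exists _ : unit, [set: 'rV[R]_n] p.
Proof. by exists tt. Qed.

Fact coordinate_open (_ : unit) : open [set: 'rV[R]_n].
Proof. exact: openT. Qed.

Fact coordinate_img_open (_ : unit) : open (idfun @` [set: 'rV[R]_n]).
Proof. by rewrite image_id; exact: openT. Qed.

Fact coordinate_continuous (A : set 'rV[R]_n) (_ : unit) p :
  A p -> {for p, continuous (@idfun 'rV[R]_n)}.
Proof. by move=> _; exact: cvg_id. Qed.

Fact coordinate_transition (_ _ : unit) b :
  smooth_on (idfun @` ([set: 'rV[R]_n] `&` [set: 'rV[R]_n]))
    (fun x => idfun (idfun x : 'rV[R]_n) ord0 b).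
Proof. by rewrite setIT image_id; exact: smooth_coord. Qed.

(** R^n with the identity as its only chart, so that jacobians, chart domains
    and changes of coordinates are all trivial. *)
Definition coordinate_space : smooth_manifold R n :=
  @SmoothManifold R n 'rV[R]_n unit (fun=> setT) (fun=> idfun) (fun=> idfun)
    (@norm_hausdorff R 'rV[R]_n) (@rV_second_countable R n)
    coordinate_cover coordinate_open coordinate_img_open
    (fun _ _ _ => erefl)
    (@coordinate_continuous setT) (@coordinate_continuous _)
    coordinate_transition.

Lemma jac_coordinate_space i j p : @jac R n coordinate_space i j p = 1%:M.
Proof.
apply/matrixP => a b; rewrite !mxE /partial.
by have [_ ->] := is_derive_coord p a b; rewrite eq_sym.
Qed.

Lemma img_coordinate_space i : @img R n coordinate_space i = setT.
Proof. exact: image_id. Qed.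

End CoordinateSpace.

(** * A flat metric with polynomial density *)

Section Model.
Variables (R : realType) (eps : R) (q : {poly R}).
Implicit Types (x v : 'rV[R]_3).

(** The components of dw, where w = (e^(2x) + y^2 + eps z^2) / 2. *)
Definition height_diff x (a : 'I_3) : R :=
  if a == 0 then expR (2 * x ord0 0) else
  if a == 1 then x ord0 1 else eps * x ord0 2.

(** The Hessian of w in the coordinates (x, y, z), which is diagonal because
    w is a sum of functions of one coordinate each. *)
Definition height_hess x (c a : 'I_3) : R :=
  (a == c)%:R * if a == 0 then 2 * expR (2 * x ord0 0) else
                if a == 1 then 1 else eps.

Lemma is_derive_height_diff x c a :
  is_derive x 'e_c (height_diff ^~ a) (height_hess x c a).
Proof.
rewrite /height_diff /height_hess; elim/ord3_case: a => /=.
- by have := is_derive_exp_coord 2 x c 0; rewrite mulrA.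
- by rewrite mulr1; exact: is_derive_coord.
- rewrite (_ : (fun _ => _) = eps \*: (fun y : 'rV[R]_3 => y ord0 2)) //.
  by rewrite mulrC; apply: is_deriveZ; exact: is_derive_coord.
Qed.

Lemma smooth_height_diff a : smooth_on setT (height_diff ^~ a).
Proof.
rewrite /height_diff; elim/ord3_case: a => /=.
- exact: smooth_exp_coord.
- exact: smooth_coord.
- by apply: smoothM; [exact: smooth_cst | exact: smooth_coord].
Qed.

(** The metric dw^2 + dy^2 + dz^2, that is, the Euclidean metric pulled back by
    (x, y, z) |-> (w, y, z).  Working with the pull-back keeps the carrier
    equal to R^3, whereas the image of this map is a proper open subset. *)
Definition flat_metric x : 'M[R]_3 := \matrix_(a, b)
  (height_diff x a * height_diff x b + ((a == b) && (a != 0))%:R).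

Lemma flat_metric_sym x : (flat_metric x)^T = flat_metric x.
Proof.
by apply/matrixP => a b; rewrite !mxE mulrC eq_sym; case: eqP => // ->.
Qed.

Lemma flat_metric_posdef x v : v != 0 ->
  0 < (v *m flat_metric x *m v^T) ord0 ord0.
Proof.
move=> v0.
have -> : (v *m flat_metric x *m v^T) ord0 ord0 =
    (\sum_a v ord0 a * height_diff x a) ^+ 2 + v ord0 1 ^+ 2 + v ord0 2 ^+ 2.
  rewrite !mxE sum3 !mxE !sum3 !mxE /=.
  ring.
rewrite lt0r !addr_ge0 ?sqr_ge0 // andbT.
apply: contra v0; rewrite !paddr_eq0 ?addr_ge0 ?sqr_ge0 // !sqrf_eq0.
rewrite sum3 => /andP[/andP[/eqP E /eqP v1] /eqP v2].
move: E; rewrite v1 v2 !mul0r !addr0 /height_diff /= => /eqP.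
rewrite mulf_eq0 (gt_eqF (expR_gt0 _)) orbF => /eqP v0.
by apply/eqP/rowP; elim/ord3_case; rewrite mxE.
Qed.

Lemma flat_metric_unit x : flat_metric x \in unitmx.
Proof.
rewrite unitmxE unitfE; apply/negP => /det0P[v v0 vG].
by have := flat_metric_posdef x v0; rewrite vG mul0mx mxE ltxx.
Qed.

Lemma smooth_flat_metric a b : smooth_on setT (fun x => flat_metric x a b).
Proof.
rewrite (_ : (fun _ => _) = fun x => height_diff x a * height_diff x b +
    ((a == b) && (a != 0))%:R); last by apply/funext => x; rewrite mxE.
apply: smoothD; last exact: smooth_cst.
by apply: smoothM; exact: smooth_height_diff.
Qed.

Definition flat_symbols : symbols R 3 := fun x k a b =>
  (k == 0)%:R * (height_hess x a b / expR (2 * x ord0 0)).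

(** The functions w, y, z are affine for this flat metric.  The symbols are
    therefore determined by Hess w = 0, Hess y = 0 and Hess z = 0: only the
    upper index x survives, with value d_a d_b w / d_x w.  The proof checks
    the two properties that characterize the Levi-Civita connection. *)
Lemma levi_civita_flat_metric x : levi_civita flat_metric x = flat_symbols x.
Proof.
apply/esym/(@levi_civitaP _ _ setT) => //; first exact: openT.
- by move=> y _; exact: flat_metric_sym.
- exact: flat_metric_unit.
have e0 : expR (2 * x ord0 0) != 0 by rewrite gt_eqF ?expR_gt0.
split=> [k a b|c a b].
  rewrite /flat_symbols /height_hess (eq_sym b).
  by case: (altP (a =P b)) => [->|_] //; rewrite !mul0r.
have -> : partial c (fun y => flat_metric y a b) x =
    height_hess x c a * height_diff x b + height_diff x a * height_hess x c b.
  have [_ <-] : is_derive x 'e_c (fun y => flat_metric y a b)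
    (height_hess x c a * height_diff x b + height_diff x a * height_hess x c b).
    have da := is_derive_height_diff x c a.
    have db := is_derive_height_diff x c b.
    rewrite (_ : (fun _ => _) = height_diff ^~ a * height_diff ^~ b +
        cst ((a == b) && (a != 0))%:R); last by apply/funext => y; rewrite mxE.
    by apply: is_derive_eq; rewrite /GRing.scale /=; ring.
  by [].
rewrite sum3 /flat_symbols !mxE /=.
have -> : height_diff x 0 = expR (2 * x ord0 0) by [].
rewrite andbN andbF !mul0r !addr0.
by field.
Qed.

Fact model_nonempty : [set: coordinate_space R 3] !=set0.
Proof. by exists (0 : 'rV[R]_3). Qed.

Fact model_metric_change (i j : chart_index (coordinate_space R 3)) p :
  dom i p -> dom j p -> flat_metric (chart i p) =
    jac i j p *m flat_metric (chart j p) *m (jac i j p)^T.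
Proof.
by move=> _ _; rewrite jac_coordinate_space trmx1 mulmx1 mul1mx.
Qed.

Fact model_density_smooth (i : chart_index (coordinate_space R 3)) :
  smooth_on (img i) ((fun p : 'rV[R]_3 => q.[p ord0 0]) \o chart_inv i).
Proof. by rewrite img_coordinate_space; exact: smooth_horner_coord. Qed.

Fact model_metric_smooth (i : chart_index (coordinate_space R 3)) a b :
  smooth_on (img i) (fun x => flat_metric x a b).
Proof. by rewrite img_coordinate_space; exact: smooth_flat_metric. Qed.

Definition model : manifold_with_density R 3 :=
  @ManifoldWithDensity R 3 (coordinate_space R 3) model_nonempty
    (@rV_connected R 3) (fun=> flat_metric) model_metric_smooth
    (fun _ _ _ => flat_metric_sym _)
    (fun _ _ _ _ => @flat_metric_posdef _ _)
    model_metric_change _ model_density_smooth.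

Definition model_symbols : symbols R 3 := fun x k a b =>
  flat_symbols x k a b - (a == 0)%:R * q^`().[x ord0 0] * (k == b)%:R
    - (b == 0)%:R * q^`().[x ord0 0] * (k == a)%:R.

Lemma weighted_connection_model (i : chart_index model) :
  weighted_connection i = model_symbols.
Proof.
apply/funext => x; apply/funext => k; apply/funext => a; apply/funext => b.
rewrite /weighted_connection /weighted levi_civita_flat_metric.
have P c : partial c (density model \o chart_inv i) x =
    (c == 0)%:R * q^`().[x ord0 0].
  by have [_] := is_derive_horner_coord q x c 0; rewrite eq_sym.
by rewrite !P.
Qed.

End Model.

(** * One-sided derivatives along intervals *)

Section Slopes.
Variable R : realType.
Implicit Types (a b t l e : R) (f g : R -> R).

(** The scalar form of [deriv_within], spelled out with epsilons so that
    restriction to, and rescaling of, the interval are immediate. *)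
Definition slope_cvg a b f t l : Prop := forall e, 0 < e ->
  exists2 d : R, 0 < d & forall s, s \in `[a, b] -> s != t -> `|s - t| < d ->
    `|l - (s - t)^-1 * (f s - f t)| < e.

Lemma cvg_mxP (T : Type) (F : set_system T) (m n : nat) (f : T -> 'M[R]_(m, n))
    (l : 'M[R]_(m, n)) : Filter F ->
  f @ F --> l <-> forall i j, f s i j @[s --> F] --> l i j.
Proof.
move=> FF; split=> [fl i j|fl].
  exact: (cvg_comp _ _ fl (@coord_continuous R m n i j l)).
move=> A [P lP PA].
have : \forall s \near F, forall i j, P i j (f s i j).
  by do 2?[apply: filter_forall => ?]; exact: (fl _ _ _ (lP _ _)).
by apply: filterS => s Ps; apply: PA.
Qed.

Lemma within_dnbhsP a b t (P : R -> Prop) :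
  (\forall s \near within `[a, b] t^', P s) <->
  exists2 d : R, 0 < d &
    forall s, s \in `[a, b] -> s != t -> `|s - t| < d -> P s.
Proof.
split=> [/nbhs_ballP[d /= d0 dP]|[d d0 dP]].
  exists d => // s sab st sd; apply: dP => //.
  by rewrite /ball /= distrC.
apply/nbhs_ballP; exists d => //= s sd st sab.
by apply: dP => //; rewrite distrC.
Qed.

Lemma slope_cvgP a b f t l :
  (s - t)^-1 * (f s - f t) @[s --> within `[a, b] t^'] --> l <->
  slope_cvg a b f t l.
Proof.
split=> [/cvgrPdist_lt fl e e0|fl].
  by have /within_dnbhsP := fl e e0.
by apply/cvgrPdist_lt => e e0; apply/within_dnbhsP; exact: fl.
Qed.

Lemma deriv_withinP (n : nat) a b (f : R -> 'rV[R]_n) t (l : 'rV[R]_n) :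
  deriv_within a b f t l <->
  forall j, slope_cvg a b (fun s => f s ord0 j) t (l ord0 j).
Proof.
have E j : (fun s => ((s - t)^-1 *: (f s - f t)) ord0 j) =
    fun s => (s - t)^-1 * (f s ord0 j - f t ord0 j).
  by apply/funext => s; rewrite !mxE.
rewrite /deriv_within; split=> [/cvg_mxP fl j|fl].
  by apply/slope_cvgP; rewrite -E; exact: fl.
by apply/cvg_mxP => i j; rewrite ord1 E; apply/slope_cvgP.
Qed.

Lemma is_derive_distP f t l : is_derive t 1 f l <->
  forall e, 0 < e -> exists2 d : R, 0 < d & forall s, s != t -> `|s - t| < d ->
    `|l - (s - t)^-1 * (f s - f t)| < e.
Proof.
have H : h^-1 *: (f (h *: 1 + t) - f t) @[h --> 0^'] --> l <->
  forall e, 0 < e -> exists2 d : R, 0 < d & forall s, s != t -> `|s - t| < d ->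
    `|l - (s - t)^-1 * (f s - f t)| < e.
  split=> [/cvgrPdist_lt fl e e0|fl].
    have /nbhs_ballP[d /= d0 dP] := fl e e0.
    exists d => // s st sd.
    have := dP (s - t); rewrite /ball /= sub0r normrN [_ *: 1]mulr1 subrK.
    by apply=> //; rewrite subr_eq0.
  apply/cvgrPdist_lt => e e0; have [d d0 dP] := fl e e0.
  apply/nbhs_ballP; exists d => //= h; rewrite /ball /= sub0r normrN => hd h0.
  have := dP (h + t); rewrite addrK [_ *: 1]mulr1; apply=> //.
  by rewrite -subr_eq0 addrK.
rewrite -H; split=> [[fd <-]|fl]; first exact: fd.
by split; [apply/cvg_ex; exists l | exact: cvg_lim fl].
Qed.

Lemma is_derive_slope a b f t l : is_derive t 1 f l -> slope_cvg a b f t l.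
Proof.
move=> /is_derive_distP fl e /fl[d d0 dP].
by exists d => // s _; exact: dP.
Qed.

(** Away from the endpoints the one-sided notion is the usual derivative,
    which gives access to the calculus of [is_derive]. *)
Lemma slope_is_derive a b f t l :
  t \in `]a, b[ -> slope_cvg a b f t l -> is_derive t 1 f l.
Proof.
rewrite in_itv /= => /andP[lt_at lt_tb] fl.
apply/is_derive_distP => e /fl[d d0 dP].
exists (Num.min d (Num.min (t - a) (b - t))).
  by rewrite !lt_min d0 !subr_gt0 lt_at.
move=> s st; rewrite !lt_min => /and3P[sd /ltr_normlP[s1 _] /ltr_normlP[_ s2]].
by apply: dP => //; rewrite in_itv /=; apply/andP; split; lra.
Qed.

Lemma eq_slope a b f g t l : t \in `[a, b] -> {in `[a, b], f =1 g} ->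
  slope_cvg a b f t l -> slope_cvg a b g t l.
Proof.
move=> tab fg fl e /fl[d d0 dP]; exists d => // s sab st sd.
by rewrite -!fg //; exact: dP.
Qed.

(** The points of [a, b] accumulate at t, from one side at least, as soon as
    a < b. *)
Lemma slope_unique a b f t l l' : a < b -> t \in `[a, b] ->
  slope_cvg a b f t l -> slope_cvg a b f t l' -> l = l'.
Proof.
move=> ab tab fl fl'; apply/eqP; rewrite -subr_eq0 -normr_le0 leNgt.
apply/negP => ll'.
have [d d0 dP] := fl _ (divr_gt0 ll' (ltr0Sn _ 1)).
have [d' d'0 dP'] := fl' _ (divr_gt0 ll' (ltr0Sn _ 1)).
(* A point of [a, b] near t, taken on the side of the farther endpoint. *)
have [s [sab st sd]] : exists s,
    [/\ s \in `[a, b], s != t & `|s - t| < Num.min d d'].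
  move: tab; rewrite in_itv /= => /andP[le_at le_tb].
  pose m := Num.min (Num.min d d') (b - a).
  have m0 : 0 < m by rewrite !lt_min d0 d'0 subr_gt0.
  have [mb mm] : m <= b - a /\ m <= Num.min d d'.
    by rewrite /m; split; rewrite ge_min lexx ?orbT.
  have [tm|tm] := leP t ((a + b) / 2).
    exists (t + m / 2); rewrite in_itv /=; split.
    - by apply/andP; split; lra.
    - by rewrite gt_eqF //; lra.
    - by rewrite (addrC t) addrK ger0_norm; lra.
  exists (t - m / 2); rewrite in_itv /=; split.
  - by apply/andP; split; lra.
  - by rewrite lt_eqF //; lra.
  - by rewrite (addrC t) addrK normrN ger0_norm; lra.
move: sd; rewrite lt_min => /andP[sd sd'].
have := dP s sab st sd; have := dP' s sab st sd'.
set k := _ * _ => k1 k2.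
have := ler_distD k l l'; rewrite (distrC k); lra.
Qed.

Lemma slope_continuous a b f : (forall t, t \in `[a, b] ->
    exists l, slope_cvg a b f t l) -> {within `[a, b], continuous f}.
Proof.
move=> fl; apply/subspace_continuousP => t /= /fl[l /(_ 1 ltr01)[d d0 dP]].
apply/cvgrPdist_lt => e e0; rewrite near_withinE.
have c0 : 0 < `|l| + 1 by rewrite ltr_wpDl.
apply/nbhs_ballP; exists (Num.min d (e / (`|l| + 1))).
  by rewrite /= lt_min d0 divr_gt0.
move=> s /=; rewrite /ball /= distrC lt_min => /andP[sd se] sab.
have [->|st] := eqVneq s t; first by rewrite subrr normr0.
have /= := dP s sab st sd; set k := _ * _ => lk.
have st0 : s - t != 0 by rewrite subr_eq0.
have -> : f t - f s = - ((s - t) * k) by rewrite /k mulVKf // opprB.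
rewrite normrN normrM.
have kl : `|k| <= `|l| + 1.
  by have := ler_distD l k 0; rewrite !subr0 (distrC k); lra.
apply: le_lt_trans (ler_wpM2l (normr_ge0 _) kl) _.
by rewrite -ltr_pdivlMr.
Qed.

Lemma within_cst a b f : a <= b -> {within `[a, b], continuous f} ->
  (forall t, t \in `]a, b[ -> is_derive t 1 f 0) -> f a = f b.
Proof.
move=> ab fc fd; have [c _] := MVT_segment ab fd fc.
by rewrite mul0r => /eqP; rewrite subr_eq0 => /eqP ->.
Qed.

(** By the intermediate value theorem a change of sign would produce a zero. *)
Lemma within_neq0_gt0 a b f : a <= b -> {within `[a, b], continuous f} ->
  (forall t, t \in `[a, b] -> f t != 0) -> 0 < f a -> 0 < f b.
Proof.
move=> ab fc f0 fa; rewrite ltNge; apply/negP => fb.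
have [|c cab /eqP] := IVT (v := 0) ab fc; last by rewrite (negbTE (f0 c cab)).
by rewrite ge_min le_max fb (ltW fa) orbT.
Qed.

End Slopes.

(** * A frame adapted to the weighted connection *)

Section Gauge.
Variables (R : realType) (eps : R) (q : {poly R}).
Implicit Types (x v w : 'rV[R]_3) (gam U V : R -> 'rV[R]_3).

(** The factors by which the coordinate frame is rescaled.  They are chosen
    so that the rescaled frame is parallel along x-lines: there
    V_x' = (2 phi' - 2) V_x and V_k' = phi' V_k for k = y, z. *)
Definition frame x (k : 'I_3) : R :=
  if k == 0 then expR q.[x ord0 0] ^+ 2 / expR (2 * x ord0 0)
  else expR q.[x ord0 0].

Lemma frame_gt0 x k : 0 < frame x k.
Proof.
by rewrite /frame; case: ifP => _; rewrite ?divr_gt0 ?exprn_gt0 ?expR_gt0.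
Qed.

Lemma frame_neq0 x k : frame x k != 0.
Proof. by rewrite gt_eqF ?frame_gt0. Qed.

(** The connection form in the rescaled frame, evaluated on the vector w, as a
    matrix acting on rows: a field with components U is parallel when
    U' = U *m connection_form.  The component w_x does not occur. *)
Definition connection_form x w : 'M[R]_3 := \matrix_(i, j)
  if j == 0 then
    if i == 0 then 0
    else - (if i == 1 then 1 else eps) * w ord0 i / expR q.[x ord0 0]
  else if i == 0 then
    w ord0 j * q^`().[x ord0 0] * expR q.[x ord0 0] / expR (2 * x ord0 0)
  else 0.

Definition christoffel_term x w v (k : 'I_3) : R :=
  \sum_c \sum_d model_symbols eps q x k c d * w ord0 c * v ord0 d.

Lemma is_derive_frame gam (t w0 : R) k :
  is_derive t 1 (fun s => gam s ord0 0) w0 ->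
  is_derive t 1 (fun s => frame (gam s) k)
    (frame (gam t) k * w0 * (if k == 0 then 2 * q^`().[gam t ord0 0] - 2
                             else q^`().[gam t ord0 0])).
Proof.
move=> dg; set g := fun s => gam s ord0 0 in dg.
have E : is_derive t 1 (expR \o (horner q \o g))
    (q^`().[g t] * w0 * expR q.[g t]).
  by apply: is_derive_eq; rewrite /GRing.scale /=; ring.
rewrite /frame; case: ifP => _.
  have D : is_derive t 1 (expR \o (-2 \*: g)) (- 2 * w0 * expR (- 2 * g t)).
    by apply: is_derive_eq; rewrite /GRing.scale /=; ring.
  rewrite (_ : (fun _ => _) =
      (expR \o (horner q \o g)) ^+ 2 * (expR \o (-2 \*: g))).
    apply: is_derive_eq; rewrite /GRing.scale /= -expRN -mulNr -/(g t).
    by rewrite !fctE /= /GRing.scale /=; ring.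
  apply/funext => s; rewrite -expRN -mulNr.
  by rewrite !fctE.
by apply: (is_derive_eq E); rewrite /g; ring.
Qed.

Lemma christoffel_termE x w v k (dphi := q^`().[x ord0 0])
    (Y := expR (2 * x ord0 0)) :
  christoffel_term x w v k =
    if k == 0 then (2 - 2 * dphi) * w ord0 0 * v ord0 0 +
      (w ord0 1 * v ord0 1 + eps * w ord0 2 * v ord0 2) / Y
    else - dphi * (w ord0 0 * v ord0 k + w ord0 k * v ord0 0).
Proof.
have Y0 : Y != 0 by rewrite gt_eqF ?expR_gt0.
rewrite /christoffel_term !sum3 /model_symbols /flat_symbols /height_hess.
rewrite -/dphi -/Y.
by elim/ord3_case: k => /=; field.
Qed.

Lemma mulmx_connection_form (u : 'rV[R]_3) x w k (dphi := q^`().[x ord0 0])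
    (X := expR q.[x ord0 0]) (Y := expR (2 * x ord0 0)) :
  (u *m connection_form x w) ord0 k =
    if k == 0 then - (w ord0 1 * u ord0 1 + eps * w ord0 2 * u ord0 2) / X
    else w ord0 k * dphi * X / Y * u ord0 0.
Proof.
have Y0 : Y != 0 by rewrite gt_eqF ?expR_gt0.
have X0 : X != 0 by rewrite gt_eqF ?expR_gt0.
rewrite mxE sum3 !mxE /= -/X -/Y -/dphi.
by elim/ord3_case: k => /=; field.
Qed.

(** Converts a solution in the rescaled frame into a parallel field.  Used to
    build explicit translations. *)
Lemma frame_parallel gam (t : R) w U :
  is_derive t 1 (fun s => gam s ord0 0) (w ord0 0) ->
  (forall k, is_derive t 1 (fun s => U s ord0 k)
     ((U t *m connection_form (gam t) w) ord0 k)) ->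
  forall k, is_derive t 1 (fun s => U s ord0 k * frame (gam s) k)
    (- christoffel_term (gam t) w
         (\row_j (U t ord0 j * frame (gam t) j)) k).
Proof.
move=> dg dU k; have dF := is_derive_frame k dg.
have D := dU k.
apply: (is_derive_eq (is_deriveM D dF)).
have Y0 : expR (2 * gam t ord0 0) != 0 by rewrite gt_eqF ?expR_gt0.
have X0 : expR q.[gam t ord0 0] != 0 by rewrite gt_eqF ?expR_gt0.
rewrite christoffel_termE mulmx_connection_form !mxE /frame /GRing.scale.
by elim/ord3_case: k {D dF} => /=; field; rewrite ?X0 ?Y0.
Qed.

(** The converse change of gauge.  Used to bound the holonomy. *)
Lemma parallel_frame gam (t : R) w V :
  is_derive t 1 (fun s => gam s ord0 0) (w ord0 0) ->
  (forall k, is_derive t 1 (fun s => V s ord0 k)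
     (- christoffel_term (gam t) w (V t) k)) ->
  forall k, is_derive t 1 (fun s => V s ord0 k / frame (gam s) k)
    ((\row_j (V t ord0 j / frame (gam t) j) *m
        connection_form (gam t) w) ord0 k).
Proof.
move=> dg dV k; have dF := is_derive_frame k dg.
have F0 : frame (gam t) k != 0 by exact: frame_neq0.
have D := dV k.
have DV : is_derive t 1 (fun s => (frame (gam s) k)^-1)
    (- (frame (gam t) k) ^- 2 * (frame (gam t) k * w ord0 0 *
      (if k == 0 then 2 * q^`().[gam t ord0 0] - 2
       else q^`().[gam t ord0 0]))).
  case: dF => dF1 dF2; split; first exact: derivableV.
  by rewrite deriveV // dF2.
apply: (is_derive_eq (is_deriveM D DV)).
have Y0 : expR (2 * gam t ord0 0) != 0 by rewrite gt_eqF ?expR_gt0.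
have X0 : expR q.[gam t ord0 0] != 0 by rewrite gt_eqF ?expR_gt0.
rewrite christoffel_termE mulmx_connection_form !mxE /frame /GRing.scale.
by elim/ord3_case: k {D DV dF F0} => /=; field; rewrite ?X0 ?Y0.
Qed.

End Gauge.

(** * Piecewise straight paths *)

Section Paths.
Variables (R : realType) (eps : R) (q : {poly R}).
Local Notation conn := (connection_form eps q).
Local Notation frm := (frame q).
Implicit Types (p r x v w : 'rV[R]_3) (gam : R -> 'rV[R]_3).
Implicit Types (W F : R -> 'M[R]_3).

Definition frame_vector x (u : 'rV[R]_3) : 'rV[R]_3 :=
  \row_k (u ord0 k * frm x k).

(** The rows u *m W, read in the rescaled frame, solve the transport equation
    along gam; as u ranges over all initial values, W is a fundamental
    solution. *)
Definition parallel_piece gam W (a b : R) : Prop :=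
  exists w : R -> 'rV[R]_3, forall t, t \in `[a, b] ->
  [/\ deriv_within a b gam t (w t),
      w s @[s --> within `[a, b] (nbhs t)] --> w t &
      forall u, deriv_within a b (fun s => frame_vector (gam s) (u *m W s)) t
        (- \row_k christoffel_term eps q (gam t) (w t)
                    (frame_vector (gam t) (u *m W t)) k)].

(** A piecewise C^1 path from p to r along which translation has matrix E in
    the rescaled frames of p and r.  Continuity is asked on the whole line so
    that it survives composition with the clamps of [reaches_straight]. *)
Definition reaches p r (E : 'M[R]_3) : Prop := exists s gam W,
  [/\ itv_partition 0 1 s, continuous gam,
      on_pieces s (parallel_piece gam W),
      gam 0 = p /\ gam 1 = r & W 0 = 1%:M /\ W 1 = E].

(** The translation along the straight segment from r in the direction v. *)
Definition flow r v F : Prop := F 0 = 1%:M /\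
  forall (t : R) i j, is_derive t 1 (fun s => F s i j)
    ((F t *m conn (r + t *: v) v) i j).

Lemma connection_formZ x (c : R) w : conn x (c *: w) = c *: conn x w.
Proof.
apply/matrixP => i j; rewrite !mxE; do ![case: ifP => _]; ring.
Qed.

Lemma christoffel_termZ x (c : R) w v k :
  christoffel_term eps q x (c *: w) v k = c * christoffel_term eps q x w v k.
Proof.
rewrite /christoffel_term mulr_sumr; apply: eq_bigr => i _.
by rewrite mulr_sumr; apply: eq_bigr => j _; rewrite mxE; ring.
Qed.

Lemma eq_parallel_piece gam gam' W W' (a b : R) :
  {in `[a, b], gam =1 gam'} -> {in `[a, b], W =1 W'} ->
  parallel_piece gam W a b -> parallel_piece gam' W' a b.
Proof.
move=> eg eW [w wP]; exists w => t tab; have [dg cw dV] := wP t tab.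
split=> // [|u].
  apply/deriv_withinP => j; have /deriv_withinP/(_ j) := dg.
  by apply: eq_slope => // s sab; rewrite eg.
apply/deriv_withinP => j; have /deriv_withinP/(_ j) := dV u.
rewrite (eg t) // (eW t) //.
by apply: eq_slope => // s sab; rewrite eg // eW.
Qed.

Lemma slope_halve (a b : R) (f : R -> R) t l :
  slope_cvg a b f (2 * t) l ->
  slope_cvg (a / 2) (b / 2) (fun s => f (2 * s)) t (2 * l).
Proof.
move=> fl e e0; have [d d0 dP] := fl (e / 2) (divr_gt0 e0 (ltr0Sn _ 1)).
exists (d / 2); first exact: divr_gt0.
move=> s; rewrite in_itv /= => /andP[sa sb] st sd.
have /= := dP (2 * s).
rewrite in_itv /= -mulrBr (inj_eq (mulfI _)) ?pnatr_eq0 // normrM ger0_norm //.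
have st0 : s - t != 0 by rewrite subr_eq0.
have -> : (2 * (s - t))^-1 = (s - t)^-1 / 2 by rewrite invfM mulrC.
set D := f _ - f _ => /(_ _ st _) H.
have {}H : `|l - (s - t)^-1 / 2 * D| < e / 2.
  by apply: H; [apply/andP; split; lra | lra].
have -> : 2 * l - (s - t)^-1 * D = 2 * (l - (s - t)^-1 / 2 * D) by field.
by rewrite normrM ger0_norm //; lra.
Qed.

(** The transport equation is invariant under reparametrization because the
    connection form is linear in the velocity. *)
Lemma parallel_piece_halve gam W (a b : R) : parallel_piece gam W a b ->
  parallel_piece (fun s => gam (2 * s)) (fun s => W (2 * s)) (a / 2) (b / 2).
Proof.
move=> [w wP]; exists (fun s => 2 *: w (2 * s)) => t.
have H s : s \in `[a / 2, b / 2] -> 2 * s \in `[a, b].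
  by rewrite !in_itv /= => /andP[sa sb]; apply/andP; split; lra.
move=> /H tab; have [dg cw dV] := wP _ tab; split.
- apply/deriv_withinP => j; rewrite mxE.
  apply: (@slope_halve _ _ (fun s => gam s ord0 j)).
  by have /deriv_withinP := dg; exact.
- apply: cvgZr => A /cw; rewrite /fmap /= => /nbhs_ballP[e /= e0 eA].
  apply/nbhs_ballP; exists (e / 2); first by rewrite /= divr_gt0.
  move=> s /= ts /H sab; apply: eA => //=.
  by move: ts; rewrite /ball /= -mulrBr normrM ger0_norm //; lra.
- move=> u; apply/deriv_withinP => j; rewrite !mxE christoffel_termZ -mulrN.
  apply: (@slope_halve _ _ (fun s => frame_vector (gam s) (u *m W s) ord0 j)).
  by have /deriv_withinP/(_ j) := dV u; rewrite !mxE.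
Qed.

Lemma straight_piece r v F (E : 'M[R]_3) (a b : R) : flow r v F ->
  parallel_piece (fun s => r + (2 * s - 1) *: v)
    (fun s => E *m F (2 * s - 1)) a b.
Proof.
move=> [_ dF]; exists (fun=> 2 *: v) => t tab.
have dg k : is_derive t 1 (fun s => (r + (2 * s - 1) *: v) ord0 k)
    ((2 *: v) ord0 k).
  rewrite (_ : (fun _ => _) = fun s => r ord0 k + (2 * s - 1) * v ord0 k).
    by apply: is_derive_eq; rewrite mxE /GRing.scale /=; ring.
  by apply/funext => s; rewrite !mxE.
split.
- by apply/deriv_withinP => k; exact: is_derive_slope.
- exact: cvg_cst.
- move=> u; apply/deriv_withinP => k.
  pose U s := u *m (E *m F (2 * s - 1)).
  have dU : forall k, is_derive t 1 (fun s => U s ord0 k)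
      ((U t *m conn (r + (2 * t - 1) *: v) (2 *: v)) ord0 k).
    move=> {}k; rewrite connection_formZ -scalemxAr /U !mulmxA.
    set u' := u *m E.
    have dFk i : is_derive t 1 ((fun s => F s i k) \o (fun s => 2 * s - 1))
        (2 * (F (2 * t - 1) *m conn (r + (2 * t - 1) *: v) v) i k).
      have D := dF (2 * t - 1) i k.
      by apply: is_derive_eq; rewrite /GRing.scale /=; ring.
    rewrite (_ : (fun _ => _) = fun s => \sum_i u' ord0 i * F (2 * s - 1) i k).
      rewrite -mulmxA.
      rewrite (_ : _ ord0 k = \sum_i u' ord0 i *
        (2 * (F (2 * t - 1) *m conn (r + (2 * t - 1) *: v) v) i k)).
        rewrite (_ : (fun _ => _) =
          \sum_i (u' ord0 i \*: ((fun s => F s i k) \o (fun s => 2 * s - 1)))).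
          exact: is_derive_sum.
        by apply/funext => s; rewrite fct_sumE.
      rewrite mxE [X in _ * X = _]mxE mulr_sumr.
      by apply: eq_bigr => i _; ring.
    by apply/funext => s; rewrite mulmxA mxE.
  have := frame_parallel (dg 0) dU k => /(is_derive_slope a b).
  rewrite !mxE.
  by apply: eq_slope => // s _; rewrite [RHS]mxE.
Qed.

Lemma reaches_refl p : reaches p p 1%:M.
Proof.
exists [:: 1], (fun=> p), (fun=> 1%:M); split=> //.
- exact: itv_partition1.
- by move=> x; exact: cst_continuous.
- case=> // _ /=.
  apply: (@eq_parallel_piece (fun s => p + (2 * s - 1) *: 0) _
    (fun s => 1%:M *m 1%:M)).
  + by move=> s _; rewrite scaler0 addr0.
  + by move=> s _; rewrite mulmx1.
  + apply: (@straight_piece p 0 (fun=> 1%:M)); split=> // t i j.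
    rewrite scaler0 addr0 -[X in conn _ X](scale0r 0) connection_formZ scale0r.
    by rewrite mulmx0 [X in is_derive _ _ _ X]mxE; exact: is_derive_cst.
Qed.

(** The given path is run at double speed on [0, 1/2], and the segment on
    [1/2, 1].  Clamping the two parameters makes the concatenation a single
    formula that is visibly continuous. *)
Lemma reaches_straight p r v E F :
  reaches p r E -> flow r v F -> reaches p (r + v) (E *m F 1).
Proof.
move=> [s [gam [W [sP gc gP [g0 g1] [W0 W1]]]]] vF.
pose lo (x : R) := Num.min (2 * x) 1; pose hi (x : R) := Num.max (2 * x - 1) 0.
exists (rcons [seq y / 2 | y <- s] 1), (fun x : R => gam (lo x) + hi x *: v),
  (fun x : R => W (lo x) *m F (hi x)).
have lohi0 (x : R) : x <= 1 / 2 -> lo x = 2 * x /\ hi x = 0.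
  by move=> x2; split; [apply: min_l | apply: max_r]; lra.
have lohi1 (x : R) : 1 / 2 <= x -> lo x = 1 /\ hi x = 2 * x - 1.
  by move=> x2; split; [apply: min_r | apply: max_l]; lra.
split.
- have /= [sp /eqP sl] := sP; split; last by rewrite last_rcons.
  have half_last : last 0 [seq y / 2 | y <- s] = 1 / 2.
    by have := last_map (fun y : R => y / 2) s 0; rewrite mul0r sl.
  rewrite rcons_path half_last; apply/andP; split; last by lra.
  have halve_lt : {homo (fun y : R => y / 2) : y z / y < z}.
    by move=> y z yz; rewrite ltr_pM2r.
  by have := homo_path halve_lt sp; rewrite mul0r.
- have dc : continuous (fun y : R => 2 * y).
    by move=> y; apply: cvgMr; exact: cvg_id.
  have loc : continuous lo.
    by apply: min_fun_continuous => //; exact: cst_continuous.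
  have hic : continuous hi.
    apply: max_fun_continuous => [y|]; last exact: cst_continuous.
    by apply: cvgB; [exact: dc | exact: cvg_cst].
  move=> y; apply: cvgD; last by apply: cvgZr_tmp; exact: hic.
  by apply: continuous_comp; [exact: loc | exact: gc].
- move=> k; rewrite size_rcons size_map ltnS => ks.
  rewrite -rcons_cons !nth_rcons /= !size_map ltnS ks.
  have -> : 0 :: [seq y / 2 | y <- s] = [seq y / 2 | y <- 0 :: s].
    by rewrite /= mul0r.
  rewrite (nth_map 0) //=.
  case: ltngtP ks => // [ks _|ks _].
    rewrite (nth_map 0) //.
    have b1 : nth 0 s k <= 1.
      have := itv_partition_nth_le (m := k.+1) _ sP; rewrite ltnS => /(_ ks).
      by rewrite /= (set_nth_default 0).
    have le (y : R) : y \in `[nth 0 (0 :: s) k / 2, nth 0 s k / 2] -> y <= 1 / 2.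
      by rewrite in_itv /= => /andP[_]; lra.
    apply: eq_parallel_piece (parallel_piece_halve (gP k ks));
      move=> x /le/lohi0[-> ->].
      by rewrite scale0r addr0.
    by rewrite vF.1 mulmx1.
  have -> : nth 0 (0 :: s) k = 1.
    have [_ /eqP <-] := sP.
    by rewrite ks -[last 0 s]/(last 0 (0 :: s)) -nth_last.
  apply: eq_parallel_piece (straight_piece E _ _ vF) => x;
    rewrite in_itv /= => /andP[/lohi1[-> ->] _].
    by rewrite g1.
  by rewrite W1.
- have [-> ->] := lohi0 0 (ltW (divr_gt0 ltr01 (ltr0Sn R 1))).
  have [-> ->] : lo 1 = 1 /\ hi 1 = 1.
    by have [|-> ->] := lohi1 1; [|split]; lra.
  by rewrite mulr0 g0 scale0r addr0 g1 scale1r.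
- have [-> ->] := lohi0 0 (ltW (divr_gt0 ltr01 (ltr0Sn R 1))).
  have [-> ->] : lo 1 = 1 /\ hi 1 = 1.
    by have [|-> ->] := lohi1 1; [|split]; lra.
  by rewrite mulr0 W0 vF.1 mulmx1 W1.
Qed.

End Paths.

(** * Frames and endomorphisms of tangent spaces *)

Section TangentFrame.
Variables (R : realType) (eps : R) (q : {poly R}).
Local Notation M := (model eps q).
Local Notation frm := (frame q).
Local Notation frame_vector := (frame_vector q).
Implicit Types (p : M) (c u v : 'rV[R]_3).

Fact vec_is_tangent p c : (fun=> c) \in is_tangent p.
Proof.
apply/asboolP; split=> [i /(_ Logic.I) //|i j _ _].
by rewrite jac_coordinate_space mulmx1.
Qed.

(** In a single chart a tangent vector is just its row of components. *)
Definition vec p c : tangent p := Tangent (vec_is_tangent p c).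

Lemma vecK p (v : tangent p) : vec p (v tt) = v.
Proof. by apply: val_inj; apply/funext => -[]. Qed.

Lemma vec_linear p : linear (vec p).
Proof.
move=> a u v; apply: val_inj; rewrite linearP /=.
by apply/funext => i.
Qed.

HB.instance Definition _ p :=
  GRing.isLinear.Build R 'rV[R]_3 (tangent p) _ (vec p) (vec_linear p).

Definition coframe (x : 'rV[R]_3) v : 'rV[R]_3 := \row_k (v ord0 k / frm x k).

Lemma coframeK x : cancel (coframe x) (frame_vector x).
Proof. by move=> v; apply/rowP => k; rewrite !mxE divfK ?frame_neq0. Qed.

Lemma frame_vectorK x : cancel (frame_vector x) (coframe x).
Proof. by move=> v; apply/rowP => k; rewrite !mxE mulfK ?frame_neq0. Qed.

Lemma frame_vector_linear x : linear (frame_vector x).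
Proof. by move=> a u v; apply/rowP => k; rewrite !mxE mulrDl mulrA. Qed.

HB.instance Definition _ x :=
  GRing.isLinear.Build R 'rV[R]_3 'rV[R]_3 _ (frame_vector x)
    (frame_vector_linear x).

Definition moving_frame p (j : 'I_3) : tangent p :=
  vec p (frame_vector p 'e_j).

Lemma moving_frame_sum p (c : 'rV[R]_3) :
  \sum_k c ord0 k *: moving_frame p k = vec p (frame_vector p c).
Proof.
rewrite [in RHS](row_sum_delta c) !linear_sum /=.
by apply: eq_bigr => k _; rewrite !linearZ.
Qed.

Lemma moving_frame_basis p : tangent_basis (moving_frame p).
Proof.
move=> v; exists (coframe p (v tt)); split.
  by rewrite moving_frame_sum coframeK vecK.
move=> c ->; rewrite moving_frame_sum; exact: frame_vectorK.
Qed.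

(** The endomorphism of the tangent space whose matrix in the rescaled frame
    is E. *)
Definition frame_endo p (E : 'M[R]_3) (v : tangent p) : tangent p :=
  vec p (frame_vector p (coframe p (v tt) *m E)).

Lemma frame_endo_linear p E : linear (@frame_endo p E).
Proof.
move=> a u v; rewrite /frame_endo.
have -> : coframe p ((a *: u + v) tt) =
    a *: coframe p (u tt) + coframe p (v tt).
  have /(congr1 (@^~ tt)) /= -> : val (a *: u + v) = a *: val u + val v.
    by rewrite linearP.
  by apply/rowP => k; rewrite !mxE mulrDl mulrA.
by rewrite mulmxDl -scalemxAl !linearP.
Qed.

HB.instance Definition _ p E :=
  GRing.isLinear.Build R (tangent p) (tangent p) _ (@frame_endo p E)
    (@frame_endo_linear p E).

End TangentFrame.

(** * Holonomy computed in the frame *)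

Section HolonomyOfModel.
Variables (R : realType) (eps : R) (q : {poly R}).
Local Notation M := (model eps q).
Local Notation frm := (frame q).
Local Notation frame_vector := (frame_vector q).
Local Notation vec := (@vec R eps q).
Local Notation moving_frame := (@moving_frame R eps q).
Local Notation reaches := (reaches eps q).
Local Notation conn := (connection_form eps q).
Implicit Types (p : M).

Lemma itv_partition_nth_lt (a b : R) s k : itv_partition a b s ->
  (k < size s)%N -> nth 0 (a :: s) k < nth 0 s k.
Proof. by move=> [sp _] ks; exact: (pathP 0 sp). Qed.

(** [parallel_translation] quantifies over every velocity allowed by
    [deriv_within]; uniqueness of the derivative identifies it with the one
    carried by the path. *)
Lemma Hol_frame_endo p (E : 'M[R]_3) : reaches p p E ->
  Hol (@frame_endo R eps q p E : {linear tangent p -> tangent p}).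
Proof.
move=> [s [gam [W [sP gc gP [g0 g1] [W0 W1]]]]].
exists s, gam; split=> //.
  split=> //; first exact: continuous_subspaceT.
  move=> k ks; have [w wP] := gP k ks; exists (fun=> w) => i t tab _.
  by have [dg cw _] := wP t tab.
move=> u.
exists (fun t => (fun=> frame_vector (gam t) (coframe q p (u tt) *m W t))).
split=> [t _|k ks i t w' tab _ dg'||].
- exact: vec_is_tangent.
- have [w wP] := gP k ks; have [dg cw dV] := wP t tab.
  have -> : w' = w t.
    apply/rowP => j; have lt := itv_partition_nth_lt sP ks.
    apply: (slope_unique lt tab).
      exact: ((deriv_withinP _ _ _ _ _).1 dg').
    exact: ((deriv_withinP _ _ _ _ _).1 dg).
  by rewrite weighted_connection_model; exact: dV.
- apply/funext => -[]; rewrite g0 W0 mulmx1; exact: coframeK.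
- by apply/funext => -[]; rewrite g1 W1.
Qed.

Lemma continuous_frame k : continuous (fun x : R => frm (const_mx x) k).
Proof.
move=> x; apply: differentiable_continuous; apply/derivable1_diffP.
have dg : is_derive x 1 (fun s : R => (const_mx s : 'rV[R]_3) ord0 0) 1.
  have -> : (fun s : R => (const_mx s : 'rV[R]_3) ord0 0) = id.
    by apply/funext => s; rewrite mxE.
  exact: is_derive_id.
by have [] := is_derive_frame q k dg.
Qed.

Lemma frame_const_mx (x : 'rV[R]_3) k : frm (const_mx (x ord0 0)) k = frm x k.
Proof. by rewrite /frame !mxE. Qed.

(** What remains of parallel translation along an arbitrary C^1 piece once it is
    read in the rescaled frame: enough to differentiate invariants inside the
    piece and to compare their values at its ends. *)
Definition transport_solution (gam : R -> 'rV[R]_3) (W : R -> 'M[R]_3)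
    (a b : R) : Prop :=
  (forall i j, {within `[a, b], continuous (fun t => W t i j)}) /\
  exists w : R -> 'rV[R]_3, forall t : R, t \in `]a, b[ -> forall i j,
    is_derive t 1 (fun s => W s i j) ((W t *m conn (gam t) (w t)) i j).

(** The rows of W are the parallel fields extending the rescaled frame at p. *)
Lemma Hol_transport p (L : {linear tangent p -> tangent p}) (E : 'M[R]_3) :
  Hol L ->
  (forall j, L (moving_frame p j) = vec p (frame_vector p (row j E))) ->
  exists s gam W, [/\ itv_partition 0 1 s, W 0 = 1%:M, W 1 = E &
    on_pieces s (fun a b => a <= b /\ transport_solution gam W a b)].
Proof.
move=> [s [gam [[sP gc gP] g0 g1 LP]]] LE.
have /choice[V VP] j := LP (moving_frame p j).
exists s, gam, (fun t => \matrix_(j, k) (V j t tt ord0 k / frm (gam t) k)).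
split=> //.
- apply/matrixP => j k; rewrite !mxE; have [_ _ -> _] := VP j.
  by rewrite /= g0 !mxE eqxx mulfK ?frame_neq0 // eq_sym.
- apply/matrixP => j k; rewrite !mxE; have [_ _ _ ->] := VP j.
  by rewrite LE /= g1 !mxE mulfK ?frame_neq0.
move=> k ks; have [w wP] := gP k ks.
have lt := itv_partition_nth_lt sP ks; split; first exact: ltW.
set a := nth 0 (0 :: s) k in wP lt *; set b := nth 0 s k in wP lt *.
have dg t : t \in `[a, b] -> forall j,
    slope_cvg a b (fun s => gam s ord0 j) t (w tt t ord0 j).
  move=> tab j; have [dg _] := wP tt t tab Logic.I.
  exact: ((deriv_withinP _ _ _ _ _).1 dg).
have dV t i : t \in `[a, b] -> forall j,
    slope_cvg a b (fun s => V i s tt ord0 j) t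
      (- christoffel_term eps q (gam t) (w tt t) (V i t tt) j).
  move=> tab j; have [dgt _] := wP tt t tab Logic.I.
  have [_ VO _ _] := VP i; have := VO k ks tt t _ tab Logic.I dgt.
  rewrite weighted_connection_model => /deriv_withinP/(_ j).
  by rewrite !mxE.
split=> [i j|].
  rewrite (_ : (fun _ => _) = fun t =>
      V i t tt ord0 j * (frm (const_mx (gam t ord0 0)) j)^-1); last first.
    by apply/funext => t; rewrite mxE frame_const_mx.
  move=> t; apply: cvgM.
    by apply: slope_continuous => {}t /dV/(_ j) dVt; eexists; exact: dVt.
  apply: cvgV; first exact: frame_neq0.
  have gamc : {within `[a, b], continuous (fun x => gam x ord0 0)}.
    by apply: slope_continuous => {}t /dg/(_ 0) dgt; eexists; exact: dgt.
  exact (cvg_comp _ _ (gamc t) (@continuous_frame j _)).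
exists (w tt) => t tab i j.
have tab' : t \in `[a, b] by apply: subset_itv_oo_cc tab.
have dgt := slope_is_derive tab (dg t tab' 0).
have dVt l := slope_is_derive tab (dV t i tab' l).
have := parallel_frame dgt dVt j.
rewrite (_ : (fun s => (\matrix_(_, _) _) i j) =
  fun s => V i s tt ord0 j / frm (gam s) j); last first.
  by apply/funext => x; rewrite mxE.
rewrite !mxE; set S1 := \sum_(_ < _) _; set S2 := \sum_(_ < _) _.
suff -> : S1 = S2 by [].
by apply: eq_bigr => l _; rewrite !mxE.
Qed.

(** The transposes come from the two conventions: the matrix of an endomorphism
    lists the images of the frame in columns, while translation acts on rows. *)
Lemma Hol_isP (G : set 'M[R]_3) :
  (forall p A, G A -> reaches p p A^T) ->
  (forall s gam W, itv_partition 0 1 s -> W 0 = 1%:M ->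
    on_pieces s (fun a b => a <= b /\ transport_solution gam W a b) ->
    G (W 1)^T) ->
  Hol_is M G.
Proof.
move=> lower upper p; exists (moving_frame p); first exact: moving_frame_basis.
have sumE (A : 'M[R]_3) j : \sum_k A k j *: moving_frame p k =
    vec p (frame_vector p (row j A^T)).
  by rewrite -moving_frame_sum; apply: eq_bigr => k _; rewrite !mxE.
apply/seteqP; split=> [A GA|A [L LH LA]].
  exists (@frame_endo R eps q p A^T).
    exact: Hol_frame_endo (lower p A GA).
  by move=> j; rewrite sumE /= /frame_endo /moving_frame /= frame_vectorK -rowE.
have LE j : L (moving_frame p j) = vec p (frame_vector p (row j A^T)).
  by rewrite LA sumE.
have [s [gam [W [sP W0 W1 WP]]]] := Hol_transport LH LE.
by rewrite -(trmxK A) -W1; exact: upper sP W0 WP.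
Qed.

End HolonomyOfModel.

(** * Generation of the special linear group *)

Lemma det3 (R : comNzRingType) (A : 'M[R]_3) : \det A =
  A 0 0 * (A 1 1 * A 2 2 - A 1 2 * A 2 1) -
  A 0 1 * (A 1 0 * A 2 2 - A 1 2 * A 2 0) +
  A 0 2 * (A 1 0 * A 2 1 - A 1 1 * A 2 0).
Proof.
pose a (i j : nat) := A (inord i) (inord j).
have aE i j : A i j = a (val i) (val j) by rewrite /a !inord_val.
rewrite (expand_det_row A 0) sum3 /cofactor !(expand_det_row _ 0).
rewrite !big_ord_recr !big_ord0 /= /cofactor !det_mx11 !mxE !aE /= /bump /=.
rewrite !modn_small //= !add0n /= expr0 expr1.
ring.
Qed.

Lemma mulmx3 (R : pzSemiRingType) (A B : 'M[R]_3) i j :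
  (A *m B) i j = A i 0 * B 0 j + A i 1 * B 1 j + A i 2 * B 2 j.
Proof. by rewrite mxE sum3. Qed.

Lemma matrix3P (T : Type) (A B : 'M[T]_3) :
  (A 0 0 = B 0 0 /\ A 0 1 = B 0 1 /\ A 0 2 = B 0 2) ->
  (A 1 0 = B 1 0 /\ A 1 1 = B 1 1 /\ A 1 2 = B 1 2) ->
  (A 2 0 = B 2 0 /\ A 2 1 = B 2 1 /\ A 2 2 = B 2 2) -> A = B.
Proof.
move=> [? [? ?]] [? [? ?]] [? [? ?]]; apply/matrixP.
by elim/ord3_case; elim/ord3_case.
Qed.

Definition elementary (R : pzRingType) (i j : 'I_3) (t : R) : 'M[R]_3 :=
  1%:M + t *: delta_mx i j.

Lemma mulmx_elementary (R : pzRingType) (A : 'M[R]_3) i j t k l :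
  (A *m elementary i j t) k l = A k l + A k i * t * (l == j)%:R.
Proof.
rewrite mulmxDr mulmx1 mxE; congr (_ + _).
rewrite mxE (bigD1 i) //= big1 => [|m mi].
  by rewrite !mxE eqxx addr0 mulrA.
by rewrite !mxE (negbTE mi) mulr0 mulr0.
Qed.

Section SpecialLinear.
Variable F : fieldType.
Implicit Types (A E : 'M[F]_3) (H : 'M[F]_3 -> Prop).

Lemma det_mulmx_elementary A i j t : i != j ->
  \det (A *m elementary i j t) = \det A.
Proof.
move=> ij; rewrite det_mulmx (_ : \det (elementary i j t) = 1) ?mulr1 //.
rewrite det3 !mxE.
by elim/ord3_case: i ij; elim/ord3_case: j => //= _; ring.
Qed.

Section Generation.
Variable H : 'M[F]_3 -> Prop.
Hypothesis H1 : H 1%:M.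
Hypothesis H_elementary : forall E i j t, i != j ->
  H E -> H (E *m elementary i j t).

Lemma elementary_cancel A i j t : i != j -> H (A *m elementary i j t) -> H A.
Proof.
move=> ij HA; have := H_elementary (- t) ij HA.
suff -> : A *m elementary i j t *m elementary i j (- t) = A by [].
apply/matrixP => k l; rewrite !mulmx_elementary (negbTE ij) /=.
ring.
Qed.

Lemma SL3_row2 A : \det A = 1 ->
  A 0 0 = 1 -> A 0 1 = 0 -> A 0 2 = 0 -> A 1 0 = 0 -> A 1 1 = 1 -> A 1 2 = 0 ->
  H A.
Proof.
move=> dA a00 a01 a02 a10 a11 a12.
have a22 : A 2 2 = 1 by rewrite -dA det3 a00 a01 a02 a10 a11 a12; ring.
apply: (@elementary_cancel _ 2 0 (- A 2 0)) => //.
apply: (@elementary_cancel _ 2 1 (- A 2 1)) => //.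
rewrite (_ : _ *m _ = 1%:M) //.
by apply: matrix3P; rewrite !mulmx_elementary !mxE /=
  ?a00 ?a01 ?a02 ?a10 ?a11 ?a12 ?a22; repeat split; ring.
Qed.

Lemma SL3_row1 A : \det A = 1 -> A 0 0 = 1 -> A 0 1 = 0 -> A 0 2 = 0 ->
  A 1 1 = 1 -> H A.
Proof.
move=> dA a00 a01 a02 a11.
apply: (@elementary_cancel _ 1 0 (- A 1 0)) => //.
apply: (@elementary_cancel _ 1 2 (- A 1 2)) => //.
apply: SL3_row2; rewrite ?det_mulmx_elementary // !mulmx_elementary /=
  ?a00 ?a01 ?a02 ?a11; ring.
Qed.

Lemma SL3_row1_pivot A : \det A = 1 -> A 0 0 = 1 -> A 0 1 = 0 -> A 0 2 = 0 ->
  A 1 2 != 0 -> H A.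
Proof.
move=> dA a00 a01 a02 a12.
apply: (@elementary_cancel _ 2 1 ((1 - A 1 1) / A 1 2)) => //.
apply: SL3_row1; rewrite ?det_mulmx_elementary // !mulmx_elementary /=
  ?a00 ?a01 ?a02; by [ring | field].
Qed.

Lemma SL3_row0_clear A :
  \det A = 1 -> A 0 0 = 1 -> A 0 1 = 0 -> A 0 2 = 0 -> H A.
Proof.
move=> dA a00 a01 a02.
have [a12|a12] := eqVneq (A 1 2) 0; last exact: SL3_row1_pivot.
have a11 : A 1 1 != 0.
  apply/eqP => a11; move: dA; rewrite det3 a00 a01 a02 a11 a12 => /eqP.
  by rewrite !(mul0r, mulr0, subr0, addr0) eq_sym oner_eq0.
apply: (@elementary_cancel _ 1 2 1) => //.
apply: SL3_row1_pivot; rewrite ?det_mulmx_elementary // !mulmx_elementary /=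
  ?a00 ?a01 ?a02 ?a12; try ring.
by rewrite add0r !mulr1.
Qed.

Lemma SL3_row0 A : \det A = 1 -> A 0 0 = 1 -> H A.
Proof.
move=> dA a00.
apply: (@elementary_cancel _ 0 1 (- A 0 1)) => //.
apply: (@elementary_cancel _ 0 2 (- A 0 2)) => //.
apply: SL3_row0_clear; rewrite ?det_mulmx_elementary // !mulmx_elementary /=
  ?a00; ring.
Qed.

Lemma SL3_row0_pivot A : \det A = 1 -> A 0 1 != 0 -> H A.
Proof.
move=> dA a01.
apply: (@elementary_cancel _ 1 0 ((1 - A 0 0) / A 0 1)) => //.
apply: SL3_row0; rewrite ?det_mulmx_elementary // !mulmx_elementary /=.
by field.
Qed.

(** Gaussian elimination by column operations.  The pivots are made equal to 1
    by adding a multiple of another column, since columns cannot be rescaled;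
    the last pivot is 1 because of the determinant. *)
Lemma SL3_generated A : \det A = 1 -> H A.
Proof.
move=> dA; have [a01|a01] := eqVneq (A 0 1) 0; last exact: SL3_row0_pivot.
have [a02|a02] := eqVneq (A 0 2) 0.
  have a00 : A 0 0 != 0.
    apply/eqP => a00; move: dA; rewrite det3 a00 a01 a02 => /eqP.
    by rewrite !(mul0r, subr0, addr0) eq_sym oner_eq0.
  apply: (@elementary_cancel _ 0 1 1) => //.
  apply: SL3_row0_pivot; rewrite ?det_mulmx_elementary // mulmx_elementary /=.
  by rewrite a01 add0r !mulr1.
apply: (@elementary_cancel _ 2 1 1) => //.
apply: SL3_row0_pivot; rewrite ?det_mulmx_elementary // mulmx_elementary /=.
by rewrite a01 add0r !mulr1.
Qed.

End Generation.

End SpecialLinear.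

(** * Generation of the isometry groups *)

(** The matrix that acts by [a, b; c, d] on the plane (0, k) and fixes the third
    axis, for k != 0. *)
Definition planar (R : pzRingType) (k : 'I_3) (a b c d : R) : 'M[R]_3 :=
  \matrix_(i, j)
    if i == 0 then (if j == 0 then a else if j == k then b else 0)
    else if i == k then (if j == 0 then c else if j == k then d else 0)
    else (i == j)%:R.

Definition form_mx (R : pzRingType) (eps : R) : 'M[R]_3 :=
  diag_mx (\row_j if j == 2 then eps else 1).

Lemma mulmx_form (R : comNzRingType) (eps : R) (A B : 'M[R]_3) i j :
  (A *m form_mx eps *m B^T) i j =
  A i 0 * B j 0 + A i 1 * B j 1 + eps * A i 2 * B j 2.
Proof. by rewrite mulmx3 !mul_mx_diag !mxE /=; ring. Qed.

Lemma mulmx_planar1 (R : comNzRingType) (A : 'M[R]_3) a b c d i :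
  let B := A *m planar 1 a b c d in
  [/\ B i 0 = A i 0 * a + A i 1 * c, B i 1 = A i 0 * b + A i 1 * d
    & B i 2 = A i 2].
Proof. by move=> B; split; rewrite mulmx3 !mxE /=; ring. Qed.

Lemma mulmx_planar2 (R : comNzRingType) (A : 'M[R]_3) a b c d i :
  let B := A *m planar 2 a b c d in
  [/\ B i 0 = A i 0 * a + A i 2 * c, B i 1 = A i 1
    & B i 2 = A i 0 * b + A i 2 * d].
Proof. by move=> B; split; rewrite mulmx3 !mxE /=; ring. Qed.

Section Isometries.
Variables (R : rcfType) (eps : R).
Hypothesis eps2 : eps ^+ 2 = 1.
Implicit Types (E : 'M[R]_3).

(** Isometries of diag(1, 1, eps) of determinant 1; for eps = -1 the last
    condition says that the two sheets of the hyperboloid are not exchanged. *)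
Definition proper_isometry E : Prop :=
  [/\ E *m form_mx eps *m E^T = form_mx eps, \det E = 1 &
      eps = 1 \/ 0 < E 2 2].

Lemma form_mxE i j : form_mx eps i j =
  (i == j)%:R * (if i == 2 then eps else 1).
Proof.
by rewrite !mxE; case: (altP (i =P j)) => [->|_]; rewrite ?mul1r ?mul0r.
Qed.

Lemma isometryP E : E *m form_mx eps *m E^T = form_mx eps -> forall i j,
  E i 0 * E j 0 + E i 1 * E j 1 + eps * E i 2 * E j 2 =
    (i == j)%:R * (if i == 2 then eps else 1).
Proof. by move=> EE i j; rewrite -mulmx_form EE form_mxE. Qed.

Variable H : 'M[R]_3 -> Prop.
Hypothesis H1 : H 1%:M.
Hypothesis H_planar1 : forall E c s, c ^+ 2 + s ^+ 2 = 1 ->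
  H E -> H (E *m planar 1 c s (- s) c).
Hypothesis H_planar2 : forall E c s, c ^+ 2 + eps * s ^+ 2 = 1 ->
  eps = 1 \/ 0 < c -> H E -> H (E *m planar 2 c s (- eps * s) c).

Lemma planar1_cancel E c s : c ^+ 2 + s ^+ 2 = 1 ->
  H (E *m planar 1 c s (- s) c) -> H E.
Proof.
move=> cs /(@H_planar1 _ c (- s)); rewrite sqrrN => /(_ cs).
suff -> : E *m planar 1 c s (- s) c *m planar 1 c (- s) (- - s) c = E by [].
have e i : E i 0 = E i 0 * (c ^+ 2 + s ^+ 2) /\
    E i 1 = E i 1 * (c ^+ 2 + s ^+ 2) by rewrite cs !mulr1.
apply/matrixP => i; have [e0 e1] := e i.
have [p0 p1 p2] := mulmx_planar1 E c s (- s) c i.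
have [] := mulmx_planar1 (E *m planar 1 c s (- s) c) c (- s) (- - s) c i.
rewrite p0 p1 p2 => q0 q1 q2.
by elim/ord3_case; rewrite ?q0 ?q1 ?q2 // ?[RHS]e0 ?[RHS]e1; ring.
Qed.

Lemma planar2_cancel E c s : c ^+ 2 + eps * s ^+ 2 = 1 -> eps = 1 \/ 0 < c ->
  H (E *m planar 2 c s (- eps * s) c) -> H E.
Proof.
move=> cs c0 /(@H_planar2 _ c (- s)); rewrite sqrrN => /(_ cs c0).
set P := planar _ _ _ _ _; set Q := planar _ _ _ _ _.
suff -> : E *m P *m Q = E by [].
have e i : E i 0 = E i 0 * (c ^+ 2 + eps * s ^+ 2) /\
    E i 2 = E i 2 * (c ^+ 2 + eps * s ^+ 2) by rewrite cs !mulr1.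
apply/matrixP => i; have [e0 e1] := e i.
have [p0 p1 p2] := mulmx_planar2 E c s (- eps * s) c i.
have [] := mulmx_planar2 (E *m P) c (- s) (- eps * - s) c i.
rewrite p0 p1 p2 => q0 q1 q2.
by elim/ord3_case; rewrite ?q0 ?q1 ?q2 // ?[RHS]e0 ?[RHS]e1; ring.
Qed.

Lemma isometryM E P : E *m form_mx eps *m E^T = form_mx eps ->
  P *m form_mx eps *m P^T = form_mx eps ->
  (E *m P) *m form_mx eps *m (E *m P)^T = form_mx eps.
Proof.
move=> EE PP; rewrite trmx_mul -!mulmxA [P *m _]mulmxA.
by rewrite [_ *m (P^T *m _)]mulmxA PP mulmxA.
Qed.

Lemma planar1_isometry c s : c ^+ 2 + s ^+ 2 = 1 ->
  planar 1 c s (- s) c *m form_mx eps *m (planar 1 c s (- s) c)^T = form_mx eps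
  /\ \det (planar 1 c s (- s) c) = 1.
Proof.
move=> cs; split; last by rewrite det3 !mxE /= -[RHS]cs; ring.
apply/matrixP => i j; rewrite mulmx_form form_mxE !mxE.
elim/ord3_case: i; elim/ord3_case: j => /=; first [ring | idtac].
- by rewrite mul1r -cs; ring.
- by rewrite mul1r -cs; ring.
Qed.

Lemma planar2_isometry c s (P := planar 2 c s (- eps * s) c) :
  c ^+ 2 + eps * s ^+ 2 = 1 ->
  P *m form_mx eps *m P^T = form_mx eps /\ \det P = 1.
Proof.
move=> cs; split; last by rewrite /P det3 !mxE /= -[RHS]cs; ring.
apply/matrixP => i j; rewrite /P mulmx_form form_mxE !mxE.
elim/ord3_case: i; elim/ord3_case: j => /=; first [ring | idtac].
- by rewrite mul1r -[RHS]cs; ring.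
- by rewrite mul1r -[RHS]mulr1 -[X in _ = _ * X]cs; ring.
Qed.

(** Such a matrix is a rotation of the plane (0, 1). *)
Lemma isometry_fixing_axis E : E *m form_mx eps *m E^T = form_mx eps ->
  \det E = 1 -> E 2 0 = 0 -> E 2 1 = 0 -> E 2 2 = 1 -> H E.
Proof.
move=> /isometryP EE dE e20 e21 e22.
have eps0 : eps != 0.
  apply/eqP => e0; move: eps2; rewrite e0 expr0n => /eqP.
  by rewrite eq_sym oner_eq0.
have col2 i : i != 2 -> E i 2 = 0.
  move=> i2; have := EE i 2; rewrite e20 e21 e22 (negbTE i2) /= => /eqP.
  by rewrite !mulr0 !add0r mulr1 mul0r mulf_eq0 (negbTE eps0) => /eqP.
have [e02 e12] : E 0 2 = 0 /\ E 1 2 = 0 by rewrite !col2.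
have := EE 0 0; have := EE 0 1; have := EE 1 1; rewrite e02 e12 /=.
rewrite !mulr0 !addr0 mulr1 mul0r => r11 r01 r00.
move: dE; rewrite det3 e20 e21 e22 e02 e12 => dE.
have e11 : E 1 1 = E 0 0.
  transitivity (E 1 1 * (E 0 0 * E 0 0 + E 0 1 * E 0 1) - E 0 1 *
    (E 0 0 * E 1 0 + E 0 1 * E 1 1)); last by rewrite -[RHS]mulr1 -dE; ring.
  by rewrite r00 r01; ring.
have e10 : E 1 0 = - E 0 1.
  transitivity (E 1 0 * (E 0 0 * E 0 0 + E 0 1 * E 0 1) - E 0 0 *
    (E 0 0 * E 1 0 + E 0 1 * E 1 1)); last by rewrite -[RHS]mulr1 -dE; ring.
  by rewrite r00 r01; ring.
have cs : E 0 0 ^+ 2 + E 0 1 ^+ 2 = 1 by rewrite !expr2.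
rewrite (_ : E = 1%:M *m planar 1 (E 0 0) (E 0 1) (- E 0 1) (E 0 0)).
  exact: H_planar1.
rewrite mul1mx.
by apply: matrix3P; rewrite !mxE /= ?e02 ?e12 ?e20 ?e21 ?e22 ?e10 ?e11.
Qed.

(** If the last row is (rho, 0, e), then rho^2 + eps e^2 = eps, so the planar
    isometry with entries (e, eps rho) carries this row to (0, 0, 1). *)
Lemma isometry_meridian E : proper_isometry E -> E 2 1 = 0 -> H E.
Proof.
move=> [EE dE E22] e21.
have := isometryP EE 2 2; rewrite e21 /= mul1r mulr0 addr0 => r22.
have e3 : eps * eps = 1 by rewrite -expr2.
have cs : E 2 2 ^+ 2 + eps * (eps * E 2 0) ^+ 2 = 1.
  transitivity (eps * (E 2 0 * E 2 0 + eps * E 2 2 * E 2 2) +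
    (1 - eps * eps) * (E 2 2 ^+ 2 - eps * E 2 0 ^+ 2)); first by ring.
  by rewrite r22 e3 subrr mul0r addr0.
apply: (planar2_cancel cs E22).
set P := planar _ _ _ _ _.
have [PP dP] := planar2_isometry cs.
have [q0 q1 q2] := mulmx_planar2 E (E 2 2) (eps * E 2 0)
  (- eps * (eps * E 2 0)) (E 2 2) 2.
apply: isometry_fixing_axis.
- exact: isometryM.
- by rewrite det_mulmx dE dP mulr1.
- by rewrite q0 mulNr mulrA e3; ring.
- by rewrite q1.
- rewrite q2 -[RHS]cs.
  transitivity (E 2 2 ^+ 2 + eps * E 2 0 ^+ 2); first by ring.
  by rewrite exprMn eps2 mul1r.
Qed.

(** The decomposition K A K: a rotation of the plane (0, 1) brings the last row
    into the plane (0, 2), a turn of that plane brings it to (0, 0, 1), and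
    what is left is a rotation of the plane (0, 1). *)
Lemma isometry_generated E : proper_isometry E -> H E.
Proof.
move=> [EE dE E22].
(* The rotation that turns (E_20, E_21) onto (rho, 0). *)
pose rho := Num.sqrt (E 2 0 ^+ 2 + E 2 1 ^+ 2).
have [c [s [cs e21]]] : exists c s : R, c ^+ 2 + s ^+ 2 = 1 /\
    E 2 0 * s + E 2 1 * c = 0.
  have [r0|r0] := eqVneq rho 0.
    exists 1, 0; split; first by rewrite expr1n expr0n addr0.
    have /eqP : E 2 0 ^+ 2 + E 2 1 ^+ 2 = 0.
      apply/eqP; rewrite eq_le addr_ge0 ?sqr_ge0 // andbT.
      by rewrite -sqrtr_eq0 -/rho r0.
    rewrite paddr_eq0 ?sqr_ge0 // !sqrf_eq0 => /andP[_ /eqP ->].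
    by rewrite mulr0 mul0r addr0.
  exists (E 2 0 / rho), (- E 2 1 / rho); split; last by field.
  have r2 : rho ^+ 2 = E 2 0 ^+ 2 + E 2 1 ^+ 2.
    by rewrite sqr_sqrtr // addr_ge0 ?sqr_ge0.
  rewrite !expr_div_n sqrrN -mulrDl -r2 divff // expf_neq0 //.
apply: (planar1_cancel cs); set P := planar _ _ _ _ _.
have [PP dP] := planar1_isometry cs.
have [q0 q1 q2] := mulmx_planar1 E c s (- s) c 2.
apply: isometry_meridian; last by rewrite q1.
split; [exact: isometryM | by rewrite det_mulmx dE dP mulr1 | by rewrite q2].
Qed.

End Isometries.

(** * Invariants of parallel transport *)

Lemma on_pieces_ind (R : realType) (P : R -> R -> Prop) (Q : R -> Prop) s :
  itv_partition 0 1 s -> on_pieces s P ->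
  (forall a b, P a b -> Q a -> Q b) -> Q 0 -> Q 1.
Proof.
move=> sP sPP step Q0.
have : forall k, (k <= size s)%N -> Q (nth 0 (0 :: s) k).
  elim=> // k IH ks; have := IH (ltnW ks); apply: step; exact: sPP.
move=> /(_ (size s) (leqnn _)); have [_ /eqP sl] := sP.
suff -> : nth 0 (0 :: s) (size s) = 1 by [].
by rewrite -sl -[last 0 s]/(last 0 (0 :: s)) -nth_last.
Qed.

Lemma within_const_on (R : realType) (a b t : R) (f : R -> R) :
  t \in `[a, b] -> {within `[a, b], continuous f} ->
  (forall s : R, s \in `]a, b[ -> is_derive s 1 f 0) -> f t = f a.
Proof.
rewrite in_itv /= => /andP[lt_at lt_tb] fc fd; apply/esym/within_cst => //.
  apply: continuous_subspaceW fc => x /=; rewrite !in_itv /= => /andP[-> /=] xt.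
  exact: le_trans xt lt_tb.
move=> s; rewrite in_itv /= => /andP[sa st]; apply: fd.
by rewrite in_itv /= sa (lt_le_trans st).
Qed.

Section Invariants.
Variables (R : realType) (eps : R) (q : {poly R}).
Variables (gam : R -> 'rV[R]_3) (W : R -> 'M[R]_3) (a b : R).
Hypothesis leab : a <= b.
Hypothesis Wsol : transport_solution eps q gam W a b.

Lemma mulmx_connection_formE (A : 'M[R]_3) x w i k :
  (A *m connection_form eps q x w) i k =
    if k == 0 then - (w ord0 1 * A i 1 + eps * w ord0 2 * A i 2)
                     / expR q.[x ord0 0]
    else w ord0 k * q^`().[x ord0 0] * expR q.[x ord0 0]
         / expR (2 * x ord0 0) * A i 0.
Proof.
have := mulmx_connection_form eps q (row i A) x w k.
by rewrite -row_mul !mxE => ->.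
Qed.

(** The connection form has trace zero. *)
Lemma det_transport : \det (W b) = \det (W a).
Proof.
have [Wc [w Wd]] := Wsol.
have E : (fun t => \det (W t)) = fun t =>
  W t 0 0 * (W t 1 1 * W t 2 2 - W t 1 2 * W t 2 1) -
  W t 0 1 * (W t 1 0 * W t 2 2 - W t 1 2 * W t 2 0) +
  W t 0 2 * (W t 1 0 * W t 2 1 - W t 1 1 * W t 2 0).
  by apply/funext => t; exact: det3.
apply: (@within_const_on _ a b b (fun t => \det (W t))).
- by rewrite in_itv /= leab lexx.
- rewrite E => t.
  do ?[apply: cvgD | apply: cvgN | apply: cvgM]; exact (Wc _ _ t).
- move=> t tab; rewrite E; have D := Wd t tab.
  have D00 := D 0 0; have D01 := D 0 1; have D02 := D 0 2.
  have D10 := D 1 0; have D11 := D 1 1; have D12 := D 1 2.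
  have D20 := D 2 0; have D21 := D 2 1; have D22 := D 2 2.
  apply: is_derive_eq; rewrite !mulmx_connection_formE /GRing.scale /=.
  ring.
Qed.

End Invariants.

Section IsometricTransport.
Variables (R : realType) (eps : R).
Variables (gam : R -> 'rV[R]_3) (W : R -> 'M[R]_3) (a b : R).
Hypothesis leab : a <= b.
Hypothesis Wsol : transport_solution eps 'X gam W a b.

(** For phi = x one has X^2 = Y, so the entries (0, k) and (k, 0) of the
    connection form are opposite up to the sign of the form in direction k. *)
Lemma form_transport t : t \in `[a, b] ->
  W t *m form_mx eps *m (W t)^T = W a *m form_mx eps *m (W a)^T.
Proof.
move=> tab; have [Wc [w Wd]] := Wsol; apply/matrixP => i j.
have E : (fun t => (W t *m form_mx eps *m (W t)^T) i j) = fun t =>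
    W t i 0 * W t j 0 + W t i 1 * W t j 1 + eps * W t i 2 * W t j 2.
  by apply/funext => s; exact: mulmx_form.
apply: (within_const_on (f := fun t => (W t *m form_mx eps *m (W t)^T) i j) tab).
- rewrite E => s; do ?[apply: cvgD | apply: cvgM]; try exact (Wc _ _ s).
  exact: cvg_cst.
- move=> s sab; rewrite E; have D := Wd s sab.
  have Di0 := D i 0; have Di1 := D i 1; have Di2 := D i 2.
  have Dj0 := D j 0; have Dj1 := D j 1; have Dj2 := D j 2.
  apply: is_derive_eq; rewrite !mulmx_connection_formE /GRing.scale /=.
  rewrite !hornerX derivX hornerC expRM_natl.
  have X0 : expR (gam s ord0 0) != 0 by rewrite gt_eqF ?expR_gt0.
  by field.
Qed.

End IsometricTransport.

(** * Rectangular loops *)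

(** Circular functions for sgm = 1 and hyperbolic functions for sgm = -1, with
    the properties that they share.  The last one says that they parametrize
    the circle, respectively one branch of the hyperbola. *)
Lemma turn_functions (R : realType) (sgm : R) : sgm = 1 \/ sgm = -1 ->
  exists C S : R -> R,
  [/\ C 0 = 1 /\ S 0 = 0,
      forall t : R, is_derive t 1 C (- sgm * S t) /\ is_derive t 1 S (C t),
      forall s t, C (s - t) = C s * C t + sgm * S s * S t /\
                  S (s - t) = S s * C t - C s * S t,
      forall t, C t ^+ 2 + sgm * S t ^+ 2 = 1 &
      forall c s, c ^+ 2 + sgm * s ^+ 2 = 1 -> sgm = 1 \/ 0 < c ->
        exists t, c = C t /\ s = S t].
Proof.
case=> ->.
  exists cos, sin; split.
  - by rewrite cos0 sin0.
  - move=> t; rewrite mulN1r.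
    by split; [exact: is_derive_cos | exact: is_derive_sin].
  - by move=> s t; rewrite cosB sinB mul1r.
  - by move=> t; rewrite mul1r cos2Dsin2.
  - move=> c s; rewrite mul1r => cs _.
    have c1 : -1 <= c <= 1.
      by have s2 := sqr_ge0 s; apply/andP; split; nra.
    have := sin_acos c1; rewrite (_ : 1 - c ^+ 2 = s ^+ 2); last first.
      by rewrite -cs; ring.
    rewrite sqrtr_sqr => sc.
    (* [acos] only reaches the upper half of the circle. *)
    have [s0|s0] := leP 0 s.
      by exists (acos c); rewrite acosK // sc ger0_norm.
    by exists (- acos c); rewrite cosN sinN acosK // sc ltr0_norm ?opprK.
pose C (t : R) := (expR t + expR (- t)) / 2.
pose S (t : R) := (expR t - expR (- t)) / 2.
exists C, S; split.
- by rewrite /C /S oppr0 expR0; split; field.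
- move=> t; have dN : is_derive t 1 (expR \o -%R) (- expR (- t)).
    by apply: is_derive_eq; rewrite /GRing.scale /=; ring.
  by split; apply: is_derive_eq; rewrite /C /S /GRing.scale /=; field.
- move=> s t; rewrite /C /S !opprD opprK !expRD.
  by split; field.
- move=> t; rewrite /C /S.
  have := expRN t; have : expR t != 0 by rewrite gt_eqF ?expR_gt0.
  by move=> e0 ->; field.
- move=> c s cs [/eqP|c0]; first by rewrite -subr_eq0; lra.
  have cs1 : (c + s) * (c - s) = 1 by rewrite -cs; ring.
  have cs0 : 0 < c + s.
    rewrite ltNge; apply/negP => le0.
    have c_s : 0 < c - s by lra.
    by have := mulr_le0_ge0 le0 (ltW c_s); rewrite cs1; lra.
  (* c + s = e^t when c = cosh t and s = sinh t. *)
  exists (ln (c + s)); rewrite /C /S expRN lnK // (_ : (c + s)^-1 = c - s).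
    by split; field.
  have n0 : c + s != 0 by rewrite gt_eqF.
  by apply: (mulfI n0); rewrite divff.
Qed.

Section PlanarMatrices.
Variables (R : comNzRingType) (k : 'I_3).
Hypothesis k0 : k != 0.

Lemma mulmx_planar (a b c d a' b' c' d' : R) :
  planar k a b c d *m planar k a' b' c' d' =
  planar k (a * a' + b * c') (a * b' + b * d') (c * a' + d * c')
    (c * b' + d * d').
Proof.
apply/matrixP => i j; rewrite mulmx3 !mxE.
by elim/ord3_case: k k0 => //= _; elim/ord3_case: i; elim/ord3_case: j => /=; ring.
Qed.

Lemma planar_id : planar k 1 0 0 1 = 1%:M :> 'M[R]_3.
Proof.
apply/matrixP => i j; rewrite !mxE.
by elim/ord3_case: k k0 => //= _; elim/ord3_case: i; elim/ord3_case: j.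
Qed.

Lemma elementary_planarl (t : R) : elementary k 0 t = planar k 1 0 t 1.
Proof.
apply/matrixP => i j; rewrite !mxE.
by elim/ord3_case: k k0 => //= _; elim/ord3_case: i; elim/ord3_case: j => /=; ring.
Qed.

Lemma elementary_planarr (t : R) : elementary 0 k t = planar k 1 t 0 1.
Proof.
apply/matrixP => i j; rewrite !mxE.
by elim/ord3_case: k k0 => //= _; elim/ord3_case: i; elim/ord3_case: j => /=; ring.
Qed.

End PlanarMatrices.

Section Loops.
Variables (R : realType) (eps : R) (q : {poly R}).
Local Notation reaches := (reaches eps q).
Local Notation flow := (flow eps q).
Local Notation conn := (connection_form eps q).
Implicit Types (p r v : 'rV[R]_3) (F : R -> 'M[R]_3).

Lemma eq_connection_form r r' v : r ord0 0 = r' ord0 0 -> conn r v = conn r' v.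
Proof. by move=> rr'; apply/matrixP => i j; rewrite !mxE rr'. Qed.

(** The rescaled frame is parallel along x-lines. *)
Lemma flow_longitudinal r (l : R) : flow r (l *: 'e_0) (fun=> 1%:M).
Proof.
split=> // t i j; rewrite mul1mx (_ : conn _ _ = 0).
  by rewrite [X in is_derive _ _ _ X]mxE; exact: is_derive_cst.
apply/matrixP => i' j'; rewrite !mxE /=.
by elim/ord3_case: i'; elim/ord3_case: j' => /=; ring.
Qed.

Definition transverse_flow (x : R) v F : Prop := F 0 = 1%:M /\
  forall (t : R) i j, is_derive t 1 (fun s => F s i j)
    ((F t *m conn (x *: 'e_0) v) i j).

(** The loop goes to the level x = a, by v, to the level x = b, by - v, and back
    to p.  The three longitudinal sides do not contribute. *)
Lemma reaches_rectangle p E (a b : R) v F F' : v ord0 0 = 0 ->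
  transverse_flow a v F -> transverse_flow b (- v) F' ->
  reaches p p E -> reaches p p (E *m (F 1 *m F' 1)).
Proof.
move=> v0 [F0 dF] [F'0 dF'] pE.
have conn_x r x (t : R) (w u : 'rV[R]_3) : r ord0 0 = x -> w ord0 0 = 0 ->
    conn (r + t *: w) u = conn (x *: 'e_0) u.
  move=> rx w0; apply: eq_connection_form.
  by rewrite !mxE w0 rx mulr0 addr0 mulr1.
have fF r : r ord0 0 = a -> flow r v F.
  by move=> ra; split=> // t i j; rewrite (conn_x _ a) //.
have fF' r : r ord0 0 = b -> flow r (- v) F'.
  by move=> rb; split=> // t i j; rewrite (conn_x _ b) // mxE v0 oppr0.
pose r1 := p + (a - p ord0 0) *: 'e_0; pose r2 := r1 + v.
pose r3 := r2 + (b - a) *: 'e_0; pose r4 := r3 + - v.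
have s1 : reaches p r1 (E *m 1%:M).
  exact: reaches_straight pE (flow_longitudinal _ _).
have s2 : reaches p r2 (E *m 1%:M *m F 1).
  by apply: reaches_straight s1 (fF _ _); rewrite !mxE /=; ring.
have s3 : reaches p r3 (E *m 1%:M *m F 1 *m 1%:M).
  exact: reaches_straight s2 (flow_longitudinal _ _).
have s4 : reaches p r4 (E *m 1%:M *m F 1 *m 1%:M *m F' 1).
  by apply: reaches_straight s3 (fF' _ _); rewrite !mxE v0 /=; ring.
have := reaches_straight s4 (flow_longitudinal r4 (p ord0 0 - b)).
rewrite !mulmx1 -mulmxA (_ : r4 + _ = p) //.
by apply/rowP => i; rewrite !mxE; ring.
Qed.

(** A planar matrix function solves the transport equation along d_k as soon as
    its rows solve the system with constant coefficients alpha and beta. *)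
Lemma transverse_flow_planar k (x l alpha beta : R) (a b c d : R -> R) :
  k != 0 ->
  beta = l * q^`().[x] * expR q.[x] / expR (2 * x) ->
  alpha = - (if k == 1 then 1 else eps) * l / expR q.[x] ->
  [/\ a 0 = 1, b 0 = 0, c 0 = 0 & d 0 = 1] ->
  (forall t : R,
     is_derive t 1 a (b t * alpha) /\ is_derive t 1 b (a t * beta)) ->
  (forall t : R,
     is_derive t 1 c (d t * alpha) /\ is_derive t 1 d (c t * beta)) ->
  transverse_flow x (l *: 'e_k) (fun t => planar k (a t) (b t) (c t) (d t)).
Proof.
move=> k0 betaE alphaE [a0 b0 c0 d0] dab dcd; split.
  by rewrite a0 b0 c0 d0 planar_id.
move=> t; have [da db] := dab t; have [dc dd] := dcd t.
move=> i j; rewrite (_ : (_ *m _) i j =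
    if i == 0 then (if j == 0 then b t * alpha
                    else if j == k then a t * beta else 0)
    else if i == k then (if j == 0 then d t * alpha
                         else if j == k then c t * beta else 0)
    else 0); last first.
  rewrite mulmx_connection_formE betaE alphaE !mxE /= mulr1.
  elim/ord3_case: k k0 alphaE => //= _ _;
    elim/ord3_case: i; elim/ord3_case: j => /=; ring.
rewrite (_ : (fun s => _ i j) = fun s =>
    if i == 0 then (if j == 0 then a s else if j == k then b s else 0)
    else if i == k then (if j == 0 then c s else if j == k then d s else 0)
    else (i == j)%:R); last by apply/funext => s; rewrite mxE.
case: ifP => _; first by do 2?[case: ifP => _] => //; exact: is_derive_cst.
case: ifP => ik; first by do 2?[case: ifP => _] => //; exact: is_derive_cst.
exact: is_derive_cst.
Qed.

End Loops.

(** * Turns in the models of constant curvature *)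

Section ModelLoops.
Variables (R : realType) (eps : R).
Implicit Types (p : 'rV[R]_3) (E : 'M[R]_3).

(** Only the values phi(x) = x and phi'(x) = 1 at the level itself matter, so
    this applies to both densities. *)
Lemma transverse_turn (k : 'I_3) (sgm x l : R) (C S : R -> R) :
  k != 0 -> sgm = (if k == 1 then 1 else eps) -> C 0 = 1 /\ S 0 = 0 ->
  (forall t : R, is_derive t 1 C (- sgm * S t) /\ is_derive t 1 S (C t)) ->
  forall q : {poly R}, q.[x] = x -> q^`().[x] = 1 ->
  transverse_flow eps q x (l *: 'e_k) (fun t =>
    planar k (C (l / expR x * t)) (S (l / expR x * t))
      (- sgm * S (l / expR x * t)) (C (l / expR x * t))).
Proof.
move=> k0 sgmE [C0 S0] dCS q qx q'x.
have X0 : expR x != 0 by rewrite gt_eqF ?expR_gt0.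
have lin (f : R -> R) (t f' : R) : is_derive (l / expR x * t) 1 f f' ->
    is_derive t 1 (fun s => f (l / expR x * s)) (l / expR x * f').
  move=> df; rewrite (_ : (fun _ => _) = f \o ( *%R (l / expR x))) //.
  by apply: is_derive_eq; rewrite /GRing.scale /=; ring.
apply: (transverse_flow_planar (alpha := - sgm * l / expR x)
  (beta := l / expR x)) => //.
- by rewrite qx q'x expRM_natl; field.
- by rewrite sgmE qx.
- by rewrite !mulr0 C0 S0 mulr0.
- move=> t; have [dC dS] := dCS (l / expR x * t); have dCl := lin _ _ _ dC.
  have dSl := lin _ _ _ dS.
  by split; [apply: (is_derive_eq dCl) | apply: (is_derive_eq dSl)]; field.
- move=> t; have [dC dS] := dCS (l / expR x * t); have dCl := lin _ _ _ dC.
  have dSl := lin _ _ _ dS; split.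
    rewrite (_ : (fun _ => _) = (- sgm) \*: (fun s => S (l / expR x * s))) //.
    by apply: is_derive_eq; rewrite /GRing.scale /=; field.
  by apply: (is_derive_eq dCl); field.
Qed.

(** Between the levels 0 and 1 the two transverse sides turn by l and - l / e,
    so every angle is reached by a suitable l. *)
Lemma reaches_turn (k : 'I_3) p E (sgm c s : R) :
  k != 0 -> sgm = (if k == 1 then 1 else eps) -> sgm = 1 \/ sgm = -1 ->
  c ^+ 2 + sgm * s ^+ 2 = 1 -> sgm = 1 \/ 0 < c ->
  reaches eps 'X p p E ->
  reaches eps 'X p p (E *m planar k c s (- sgm * s) c).
Proof.
move=> k0 sgmE /turn_functions[C [S [CS0 dCS addCS _ onto]]] cs c0 pE.
have [t [-> ->]] := onto c s cs c0.
pose l := t / (1 - expR (-1)).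
have X0 : expR 1 != 0 :> R by rewrite gt_eqF ?expR_gt0.
have n0 : 1 - expR (-1) != 0 :> R.
  by rewrite gt_eqF // subr_gt0 -[ltRHS]expR0 ltr_expR ltrN10.
have v0 : (l *: 'e_k : 'rV[R]_3) ord0 0 = 0.
  by rewrite !mxE /= (eq_sym 0) (negbTE k0) mulr0.
have qX (x : R) : ('X : {poly R}).[x] = x /\ ('X : {poly R})^`().[x] = 1.
  by rewrite hornerX derivX hornerC.
have fl x l' := transverse_turn (x := x) l' k0 sgmE CS0 dCS (qX x).1 (qX x).2.
have := fl 1 (- l); rewrite scaleNr => f1.
have := reaches_rectangle v0 (fl 0 l) f1 pE.
rewrite mulmx_planar // !mulr1 expR0 divr1.
have [-> ->] : C t = C (l - l / expR 1) /\ S t = S (l - l / expR 1).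
  have -> : l - l / expR 1 = t; last by [].
  by rewrite -expRN -[X in X - _]mulr1 -mulrBr /l divfK.
have [-> ->] := addCS l (l / expR 1).
have C_even u : C (- u) = C u.
  have [Cu _] := addCS 0 u; move: Cu; rewrite sub0r CS0.1 CS0.2 => ->; ring.
have S_odd u : S (- u) = - S u.
  have [_ Su] := addCS 0 u; move: Su; rewrite sub0r CS0.1 CS0.2 => ->; ring.
rewrite mulNr C_even S_odd.
set A := planar _ _ _ _ _; set B := planar _ _ _ _ _.
by suff -> : A = B by []; rewrite /A /B; congr (planar _ _ _ _ _); ring.
Qed.

End ModelLoops.

(** * Orthogonal and Lorentz holonomy *)

Section MetricModels.
Variables (R : realType) (eps : R).
Hypothesis eps1 : eps = 1 \/ eps = -1.

Let eps2 : eps ^+ 2 = 1.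
Proof. by case: eps1 => ->; rewrite ?expr1n // sqrrN expr1n. Qed.

Lemma proper_isometry_reaches p (E : 'M[R]_3) :
  proper_isometry eps E -> reaches eps 'X p p E.
Proof.
apply: (isometry_generated eps2 (H := reaches eps 'X p p)).
- exact: reaches_refl.
- move=> A c s cs pA; rewrite -[- s]mulN1r.
  apply: (@reaches_turn _ _ 1 p A 1 c s) => //; try by left.
  by rewrite mul1r.
- by move=> A c s cs c0 pA; apply: (@reaches_turn _ _ 2 p A eps c s).
Qed.

(** The form and the determinant are constant.  When eps = -1 the entry (2, 2)
    satisfies |W_22| >= 1 all along the path, so it keeps its sign. *)
Lemma transport_proper_isometry s gam (W : R -> 'M[R]_3) :
  itv_partition 0 1 s -> W 0 = 1%:M ->
  on_pieces s (fun a b => a <= b /\ transport_solution eps 'X gam W a b) ->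
  proper_isometry eps (W 1).
Proof.
move=> sP W0 sW.
apply: (on_pieces_ind (Q := fun t => proper_isometry eps (W t)) sP sW); last first.
  rewrite W0; split; first by rewrite trmx1 mulmx1 mul1mx.
    exact: det1.
  by right; rewrite mxE ltr01.
move=> a b [leab WS] [Wa dWa Wa22].
have form t : t \in `[a, b] -> W t *m form_mx eps *m (W t)^T = form_mx eps.
  by move=> tab; rewrite (form_transport WS tab).
have bab : b \in `[a, b] by rewrite in_itv /= leab lexx.
split; [exact: form | by rewrite (det_transport leab WS) | ].
case: (eps1) => e; first by left.
have {}Wa22 : 0 < W a 2 2 by case: Wa22 => // ee; move: e; rewrite ee; lra.
right; have [Wc _] := WS.
apply: (within_neq0_gt0 leab (Wc 2 2)) Wa22 => t tab; apply/eqP => W22.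
have := isometryP (form t tab) 2 2; rewrite W22 e /= !mulr0 addr0 mul1r.
by have := sqr_ge0 (W t 2 0); have := sqr_ge0 (W t 2 1); rewrite !expr2; lra.
Qed.

Lemma Hol_proper_isometry (G : set 'M[R]_3) :
  (forall A, G A <-> proper_isometry eps A^T) -> Hol_is (model eps 'X) G.
Proof.
move=> GP; apply: Hol_isP => [p A /GP|s gam W sP W0 sW].
  exact: proper_isometry_reaches.
by apply/GP; rewrite trmxK; exact: transport_proper_isometry sP W0 sW.
Qed.

End MetricModels.

Lemma SO3P (R : realType) (A : 'M[R]_3) :
  SO R 3 A <-> proper_isometry 1 A^T.
Proof.
have form1 : form_mx 1 = 1%:M :> 'M[R]_3.
  by apply/matrixP => i j; rewrite form_mxE !mxE if_same mulr1.
rewrite /SO /proper_isometry /= form1 !mulmx1 trmxK det_tr.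
by split=> [[AA dA]|[AA dA _]]; split=> //; left.
Qed.

Lemma SOpq21P (R : realType) (A : 'M[R]_3) : SOpq R 2 1 A <->
  A^T *m form_mx (-1) *m A = form_mx (-1) /\ \det A = 1.
Proof.
rewrite /SOpq /= (_ : signature_form R 2 1 = form_mx (-1)) //.
apply/matrixP => i j; rewrite form_mxE /signature_form.
rewrite mxE; case: splitP => k ik; rewrite mxE; case: splitP => l jl;
  rewrite !mxE -!val_eqE /= ik jl.
- by rewrite (ltn_eqF (ltn_ord k)) mulr1.
- by rewrite ord1 /= ltn_eqF ?mul0r // ltn_ord.
- by rewrite ord1 /= gtn_eqF ?mul0r // ltn_ord.
- by rewrite !ord1 /= mul1r.
Qed.

Lemma SOpq21_isometry (R : realType) (A : 'M[R]_3) : SOpq R 2 1 A -> 0 < A 2 2 ->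
  proper_isometry (-1) A^T.
Proof.
move=> /SOpq21P[AA dA] A22.
by split; [rewrite trmxK | rewrite det_tr | right; rewrite mxE].
Qed.

Lemma SOpq21_isometryM (R : realType) (A P : 'M[R]_3) :
  SOpq R 2 1 A -> P *m form_mx (-1) *m P^T = form_mx (-1) /\ \det P = 1 ->
  SOpq R 2 1 (P^T *m A).
Proof.
move=> /SOpq21P[AA dA] [PP dP]; apply/SOpq21P; split.
  have := isometryM (E := A^T) _ PP; rewrite trmxK => /(_ AA).
  by rewrite !trmx_mul !trmxK.
by rewrite det_mulmx det_tr dP dA mulr1.
Qed.

(** On the set of isometries the entry (2, 2) does not vanish, so it has
    constant sign on a connected subset. *)
Lemma SOplus21_gt0 (R : realType) (A : 'M[R]_3) : SOplus R 2 1 A -> 0 < A 2 2.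
Proof.
move=> [C [C1 CSO Cconn] CA].
have : connected ((fun B : 'M[R]_3 => B 2 2) @` C).
  apply: connected_continuous_connected => //.
  by apply: continuous_subspaceT; exact: coord_continuous.
move/connected_intervalP => itv; rewrite ltNge; apply/negP => A22.
have [||//|B CB /= B22] := itv (A 2 2) 1 _ _ 0; first by exists A.
- by exists 1%:M => //; rewrite mxE.
- by rewrite A22 ler01.
have /SOpq21P[BB _] := CSO B CB.
have := isometryP (E := B^T) (eps := -1); rewrite trmxK => /(_ BB 2 2).
rewrite !mxE B22 /= !mulr0 addr0 mul1r.
by have := sqr_ge0 (B 0 2); have := sqr_ge0 (B 1 2); rewrite !expr2; lra.
Qed.

Lemma connected_real (R : realType) : connected [set: R].
Proof. by apply/connected_intervalP => x y _ _ z. Qed.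

(** A turn is joined to the identity by the turns of smaller parameter. *)
Lemma SOplus21_turn (R : realType) (k : 'I_3) (A : 'M[R]_3) (sgm c s : R)
    (P := fun c s => planar k c s (- sgm * s) c) :
  sgm = 1 \/ sgm = -1 ->
  (forall c s, c ^+ 2 + sgm * s ^+ 2 = 1 ->
    P c s *m form_mx (-1) *m (P c s)^T = form_mx (-1) /\ \det (P c s) = 1) ->
  k != 0 -> c ^+ 2 + sgm * s ^+ 2 = 1 -> sgm = 1 \/ 0 < c ->
  SOplus R 2 1 A -> SOplus R 2 1 ((P c s)^T *m A).
Proof.
move=> /turn_functions[C [S [[C0 S0] dCS _ CS onto]]] Piso k0 cs c0 cA.
have [t [-> ->]] := onto c s cs c0.
have SOA : SOpq R 2 1 A by exact: (connected_component_sub cA).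
apply: (connected_component_trans cA).
exists (range (fun t => (P (C t) (S t))^T *m A)); last by exists t.
split.
- by exists 0 => //; rewrite C0 S0 /P mulr0 planar_id // trmx1 mul1mx.
- by move=> _ [u _ <-]; apply: SOpq21_isometryM (Piso _ _ (CS u)).
- apply: connected_continuous_connected; first exact: connected_real.
  apply: continuous_subspaceT => u; apply/cvg_mxP => i j.
  have [[Cd _] [Sd _]] := dCS u.
  have Cc : {for u, continuous C}.
    by apply: differentiable_continuous; exact/derivable1_diffP.
  have Sc : {for u, continuous S}.
    by apply: differentiable_continuous; exact/derivable1_diffP.
  have Pc i' j' : P (C v) (S v) i' j' @[v --> u] --> P (C u) (S u) i' j'.
    rewrite mxE; under eq_fun do rewrite mxE.
    do 4?[case: ifP => _]; try exact: cvg_cst; try exact: Cc; try exact: Sc.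
    by apply: cvgMr; exact: Sc.
  rewrite mulmx3 ![_^T _ _]mxE.
  under eq_fun do rewrite mulmx3 ![_^T _ _]mxE.
  by apply: cvgD; [apply: cvgD|]; apply: cvgMl; exact: Pc.
Qed.

Lemma SOplus21P (R : realType) (A : 'M[R]_3) :
  SOplus R 2 1 A <-> proper_isometry (-1) A^T.
Proof.
split=> [cA|AP].
  apply: SOpq21_isometry; last exact: SOplus21_gt0.
  exact: connected_component_sub cA.
have e2 : (-1) ^+ 2 = 1 :> R by rewrite sqrrN expr1n.
rewrite -(trmxK A).
apply: (isometry_generated e2 (H := fun E => SOplus R 2 1 E^T)) AP.
- rewrite trmx1; apply: connected_component_refl.
  by apply/SOpq21P; rewrite trmx1 mul1mx mulmx1 det1.
- move=> E c s cs cE; rewrite trmx_mul -[- s]mulN1r.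
  apply: (@SOplus21_turn _ 1 _ 1) => //; try by left.
    by move=> c' s'; rewrite mul1r mulN1r; exact: planar1_isometry.
  by rewrite mul1r.
- move=> E c s cs c0 cE; rewrite trmx_mul.
  apply: (@SOplus21_turn _ 2 _ (-1)) => //; first by right.
  by move=> c' s'; exact: planar2_isometry.
Qed.

(** * Special linear holonomy *)

Section SpecialLinearModel.
Variable R : realType.
Let q : {poly R} := 'X - 3^-1 *: 'X^3.
Local Notation reaches := (reaches 1 q).
Implicit Types (p : 'rV[R]_3) (E : 'M[R]_3).

Let horner_q (x : R) : q.[x] = x - x ^+ 3 / 3.
Proof. by rewrite /q hornerD hornerN hornerZ hornerXn hornerX mulrC. Qed.

Let horner_dq (x : R) : q^`().[x] = 1 - x ^+ 2.
Proof.
rewrite /q derivB derivX derivZ derivXn.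
rewrite hornerD hornerN hornerZ hornerMn hornerXn hornerC /= -mulr_natl.
by field.
Qed.

(** At a critical level of phi the connection form is nilpotent. *)
Lemma transverse_shear k (x l : R) : k != 0 -> x ^+ 2 = 1 ->
  transverse_flow 1 q x (l *: 'e_k)
    (fun t => planar k 1 0 (- (l / expR q.[x]) * t) 1).
Proof.
move=> k0 x2.
apply: (transverse_flow_planar (alpha := - (l / expR q.[x])) (beta := 0)
  (a := cst 1) (b := cst 0) (d := cst 1)) => //.
- by rewrite horner_dq x2 subrr mulr0 !mul0r.
- by rewrite if_same; ring.
- by rewrite mulr0.
- by move=> t; rewrite mul0r mulr0; split; exact: is_derive_cst.
- move=> t; rewrite mulr0; split; last exact: is_derive_cst.
  by apply: is_derive_eq; rewrite /GRing.scale /=; ring.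
Qed.

Lemma scale_e0 (k : 'I_3) (l : R) : k != 0 -> (l *: 'e_k : 'rV[R]_3) ord0 0 = 0.
Proof. by move=> k0; rewrite !mxE /= (eq_sym 0) (negbTE k0) mulr0. Qed.

(** The shears at the levels -1 and 1 do not cancel, because phi takes the
    values -2/3 and 2/3 there. *)
Lemma reaches_elementaryl k p E (t : R) : k != 0 ->
  reaches p p E -> reaches p p (E *m elementary k 0 t).
Proof.
move=> k0 pE; pose g : R := expR (2 / 3) - expR (- (2 / 3)).
have g0 : g != 0.
  by rewrite gt_eqF // subr_gt0 ltr_expR; lra.
pose l := - t / g.
have n1 : (-1 : R) ^+ 2 = 1 by rewrite sqrrN expr1n.
have s1 := transverse_shear l k0 n1.
have := transverse_shear (- l) k0 (expr1n _ 2); rewrite scaleNr => s2.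
have := reaches_rectangle (scale_e0 _ k0) s1 s2 pE.
rewrite mulmx_planar // elementary_planarl // !horner_q.
set A := planar _ _ _ _ _; set B := planar _ _ _ _ _.
suff -> : A = B by [].
rewrite /A /B; congr (planar _ _ _ _ _); try ring.
have -> : -1 - (-1) ^+ 3 / 3 = - (2 / 3) :> R by field.
have -> : 1 - 1 ^+ 3 / 3 = 2 / 3 :> R by field.
rewrite !expRN !invrK.
have e0 : expR (2 / 3) != 0 :> R by rewrite gt_eqF ?expR_gt0.
transitivity (- l * g); first by rewrite /g expRN; field.
by rewrite /l !mulNr opprK divfK.
Qed.

(** At the level 0 transport is a rotation.  The return along the level 1 adds
    a shear, which is then removed by [reaches_elementaryl]. *)
Lemma reaches_quarter_turn k p E (s : R) : k != 0 -> s ^+ 2 = 1 ->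
  reaches p p E -> reaches p p (E *m planar k 0 s (- s) 0).
Proof.
move=> k0 s2 pE.
have q0 : q.[0] = 0 by rewrite horner_q; field.
have dq0 : q^`().[0] = 1 by rewrite horner_dq; ring.
have [C [S [CS0 dCS _ CS onto]]] := turn_functions (or_introl (erefl (1 : R))).
(* t is plus or minus a quarter turn according to s. *)
have [t [C0 S1]] : exists t, 0 = C t /\ s = S t.
  by apply: onto; [rewrite expr0n add0r mul1r | left].
have s1 := transverse_turn (sgm := 1) t k0 (esym (if_same _ _)) CS0 dCS q0 dq0.
have := transverse_shear (- t) k0 (expr1n _ 2); rewrite scaleNr => s2'.
have := reaches_rectangle (scale_e0 t k0) s1 s2' pE.
rewrite expR0 divr1 !mulr1 -C0 -S1 !mulN1r -elementary_planarl // mulmxA.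
move=> /(reaches_elementaryl (- (- (- t / expR q.[1]))) k0).
rewrite -mulmxA (_ : elementary k 0 _ *m _ = 1%:M) ?mulmx1 //.
rewrite !elementary_planarl // mulmx_planar // -(planar_id R k0).
by congr (planar _ _ _ _ _); ring.
Qed.

(** A quarter turn conjugates shears into their transposes. *)
Lemma reaches_elementaryr k p E (t : R) : k != 0 ->
  reaches p p E -> reaches p p (E *m elementary 0 k t).
Proof.
move=> k0 pE.
have s1 : (1 : R) ^+ 2 = 1 by exact: expr1n.
have s2 : (-1 : R) ^+ 2 = 1 by rewrite sqrrN.
have := reaches_quarter_turn k0 s2
  (reaches_elementaryl (- t) k0 (reaches_quarter_turn k0 s1 pE)).
rewrite -!mulmxA elementary_planarl // elementary_planarr // !mulmx_planar //.
set A := planar _ _ _ _ _; set B := planar _ _ _ _ _.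
by suff -> : A = B by []; rewrite /A /B; congr (planar _ _ _ _ _); ring.
Qed.

(** The two remaining positions (1, 2) and (2, 1) are commutators of shears of
    the previous kinds. *)
Lemma reaches_elementary p E i j (t : R) : i != j ->
  reaches p p E -> reaches p p (E *m elementary i j t).
Proof.
have off k l : k != 0 -> l != 0 -> k != l -> reaches p p E ->
    reaches p p (E *m elementary k l t).
  move=> k0 l0 kl pE.
  have := reaches_elementaryr (-1) l0 (reaches_elementaryl (- t) k0
    (reaches_elementaryr 1 l0 (reaches_elementaryl t k0 pE))).
  set A := _ *m _; suff -> : A = E *m elementary k l t by [].
  apply/matrixP => i' j'; rewrite !mulmx_elementary.
  rewrite (eq_sym 0 l) (negbTE l0) (negbTE k0) (negbTE kl) eqxx /=.
  ring.
have [->|i0] := eqVneq i 0; first by rewrite eq_sym; exact: reaches_elementaryr.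
have [->|j0] := eqVneq j 0; first by move=> _; exact: reaches_elementaryl.
exact: off.
Qed.

Lemma Hol_special_linear : Hol_is (model 1 q) (SL R 3).
Proof.
apply: Hol_isP => [p A dA|s gam W sP W0 sW].
  apply: (SL3_generated (H := reaches p p)); first exact: reaches_refl.
    by move=> E i j t; exact: reaches_elementary.
  by rewrite det_tr.
rewrite /SL /= det_tr.
apply: (on_pieces_ind (Q := fun t => \det (W t) = 1) sP sW).
  by move=> a b [leab WS] <-; exact: det_transport leab WS.
by rewrite W0 det1.
Qed.

End SpecialLinearModel.

Theorem theorem1p2 (R : realType) :
  (exists M : manifold_with_density R 3, Hol_is M (SO R 3)) /\
  (exists M : manifold_with_density R 3, Hol_is M (SOplus R 2 1)) /\
  (exists M : manifold_with_density R 3, Hol_is M (SL R 3)).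
Proof.
split; last split.
- exists (model 1 'X); apply: Hol_proper_isometry; first by left.
  exact: SO3P.
- exists (model (-1) 'X); apply: Hol_proper_isometry; first by right.
  exact: SOplus21P.
- by eexists; exact: Hol_special_linear.
Qed.
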